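(* The following are equivalent over $\mathsf{RCA}_0$: (i) The strong cohesive principle $\mathsf{StCOH}$. (ii) The Bolzano-Weierstrass theorem: any bounded sequence of reals has a convergent subsequence.
   Context: $\mathsf{RCA}_0$ is the usual base system of second-order arithmetic (basic arithmetic axioms, $\Sigma^0_1$-induction, $\Delta^0_1$-comprehension). ''Equivalent over $\mathsf{RCA}_0$'' means that the equivalence, formalized in second-order arithmetic, is provable in $\mathsf{RCA}_0$. Reals. A real is a Cauchy sequence $x=(x_n)_{n\in\mathbb N}$ of rationals with no rate of convergence given: for each rational $\varepsilon>0$ there is an $N\in\mathbb N$ with $|x_m-x_n|<\varepsilon$ for all $m,n\geq N$. For reals $x,y$: $x\leq y$ means that for each rational $\varepsilon>0$ there is an $N$ with $x_n\leq y_n+\varepsilon$ for all $n\geq N$; $x=y$ means $x\leq y$ and $y\leq x$; $x<y$ means $x\leq y$ but not $x=y$. Addition, multiplication and absolute value are defined pointwise; rationals are identified with constant sequences. Sequences of reals. A sequence of reals $(x_n)_{n\in\mathbb N}$, $x_n=(x_{ni})_{i\in\mathbb N}$, is a double sequence of rationals that is uniformly Cauchy: each $\varepsilon>0$ admits an $N\in\mathbb N$ such that $|x_{ni}-x_{nj}|<\varepsilon$ for all $n\in\mathbb N$ and all $i,j\geq N$. A subsequence is given by a strictly increasing function $i\mapsto n(i)$. Convergence of $(x_n)$ to a real $x$ has the usual meaning: for each $\varepsilon>0$ there is an $N$ with $|x_n-x|<\varepsilon$ for all $n\geq N$. Principles. $\mathsf{IPP}$ (infinite pigeonhole principle): for any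 $N\in\mathbb N$ and any $c\colon\mathbb N\to\{0,\ldots,N\}$ there is an $n\leq N$ such that $\{i\in\mathbb N:c(i)=n\}$ is infinite. $\mathsf{COH}$ (cohesive principle): for any family of sets $(R_i)_{i\in\mathbb N}$, $R_i\subseteq\mathbb N$, there is an infinite set $C\subseteq\mathbb N$ such that for each $i$, $C\setminus R_i$ is finite or $C\setminus(\mathbb N\setminus R_i)$ is finite. $\mathsf{StCOH}$ is the conjunction of $\mathsf{COH}$ and $\mathsf{IPP}$. *)

(* Defs.v *)
From Stdlib Require Import List Arith.
Import ListNotations.

(** * Second-order arithmetic: syntax and provability

    Two-sorted first-order logic (numbers and sets of numbers) with de Bruijn
    indices. Number variables and set variables are indexed separately, so
    [AllNum] shifts only number indices and [AllSet] only set indices. *)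

Inductive term : Type :=
| tvar (k : nat)
| tzero
| tone
| tadd (s t : term)
| tmul (s t : term).

Inductive form : Type :=
| Bot
| Eq (s t : term)
| Lt (s t : term)
| Mem (t : term) (X : nat)
| Imp (p q : form)
| AllNum (p : form)
| AllSet (p : form).

(** The logic is classical, so the other connectives are abbreviations. *)
Definition Not p := Imp p Bot.
Definition And p q := Not (Imp p (Not q)).
Definition Or p q := Imp (Not p) q.
Definition Iff p q := And (Imp p q) (Imp q p).
Definition ExNum p := Not (AllNum (Not p)).
Definition ExSet p := Not (AllSet (Not p)).

Fixpoint tsubst (f : nat -> term) (t : term) : term :=
  match t with
  | tvar k => f k
  | tzero => tzero
  | tone => tone
  | tadd s t => tadd (tsubst f s) (tsubst f t)
  | tmul s t => tmul (tsubst f s) (tsubst f t)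
  end.

Definition scons {A : Type} (a : A) (f : nat -> A) (k : nat) : A :=
  match k with 0 => a | S k => f k end.

Definition tlift (t : term) : term := tsubst (fun k => tvar (S k)) t.

Fixpoint subst (f : nat -> term) (g : nat -> nat) (p : form) : form :=
  match p with
  | Bot => Bot
  | Eq s t => Eq (tsubst f s) (tsubst f t)
  | Lt s t => Lt (tsubst f s) (tsubst f t)
  | Mem t X => Mem (tsubst f t) (g X)
  | Imp p q => Imp (subst f g p) (subst f g q)
  | AllNum p => AllNum (subst (scons (tvar 0) (fun k => tlift (f k))) g p)
  | AllSet p => AllSet (subst f (scons 0 (fun k => S (g k))) p)
  end.

Definition liftN : form -> form := subst (fun k => tvar (S k)) (fun X => X).
Definition liftS : form -> form := subst tvar S.
Definition instN (t : term) : form -> form := subst (scons t tvar) (fun X => X).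
Definition instS (X : nat) : form -> form := subst tvar (scons X (fun Y => Y)).

(** Classical natural deduction over a set [T] of non-logical axioms.
    [prv_axiom] is available under every list of hypotheses and the eigenvariable
    conditions (the shifts in [prv_allNI] and [prv_allSI]) do not concern [T]:
    an axiom with free variables stands for its universal closure. *)
Inductive prv (T : form -> Prop) : list form -> form -> Prop :=
| prv_axiom A p : T p -> prv T A p
| prv_hyp A p : In p A -> prv T A p
| prv_impI A p q : prv T (p :: A) q -> prv T A (Imp p q)
| prv_impE A p q : prv T A (Imp p q) -> prv T A p -> prv T A q
| prv_raa A p : prv T (Not p :: A) Bot -> prv T A p
| prv_allNI A p : prv T (map liftN A) p -> prv T A (AllNum p)
| prv_allNE A p t : prv T A (AllNum p) -> prv T A (instN t p)
| prv_allSI A p : prv T (map liftS A) p -> prv T A (AllSet p)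
| prv_allSE A p X : prv T A (AllSet p) -> prv T A (instS X p)
| prv_refl A t : prv T A (Eq t t)
| prv_eq A p s t : prv T A (Eq s t) -> prv T A (instN s p) -> prv T A (instN t p).

Definition provable (T : form -> Prop) (p : form) : Prop := prv T [] p.

(** * Named binders

    Concrete formulas are written in higher-order style: a [fm] is a formula
    depending on the numbers [n] and [s] of number and set binders above it, and a
    bound variable is the level of its binder, turned into an index at each
    occurrence. A closed formula is obtained at depths [0] and [0]. *)

Definition tm := nat -> term.
Definition sv := nat -> nat.
Definition fm := nat -> nat -> form.

Definition close (p : fm) : form := p 0 0.

Definition zero : tm := fun _ => tzero.
Definition one : tm := fun _ => tone.
Definition add (a b : tm) : tm := fun n => tadd (a n) (b n).
Definition mul (a b : tm) : tm := fun n => tmul (a n) (b n).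

Definition eqn (a b : tm) : fm := fun n _ => Eq (a n) (b n).
Definition ltn (a b : tm) : fm := fun n _ => Lt (a n) (b n).
Definition mem (a : tm) (X : sv) : fm := fun n s => Mem (a n) (X s).
Definition fneg (p : fm) : fm := fun n s => Not (p n s).
Definition fimp (p q : fm) : fm := fun n s => Imp (p n s) (q n s).
Definition fconj (p q : fm) : fm := fun n s => And (p n s) (q n s).
Definition fdisj (p q : fm) : fm := fun n s => Or (p n s) (q n s).
Definition fiff (p q : fm) : fm := fun n s => Iff (p n s) (q n s).
Definition alln (P : tm -> fm) : fm :=
  fun n s => AllNum (P (fun n' => tvar (n' - S n)) (S n) s).
Definition exn (P : tm -> fm) : fm :=
  fun n s => ExNum (P (fun n' => tvar (n' - S n)) (S n) s).
Definition alls (P : sv -> fm) : fm :=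
  fun n s => AllSet (P (fun s' => s' - S s) n (S s)).
Definition exs (P : sv -> fm) : fm :=
  fun n s => ExSet (P (fun s' => s' - S s) n (S s)).

Declare Scope l2_scope.
Delimit Scope l2_scope with L2.
Notation "a + b" := (add a b) : l2_scope.
Notation "a * b" := (mul a b) : l2_scope.
Notation "a == b" := (eqn a b) (at level 70, no associativity) : l2_scope.
Notation "a < b" := (ltn a b) : l2_scope.
Notation "a <= b" := (fdisj (ltn a b) (eqn a b)) : l2_scope.
Notation "a 'IN' X" := (mem a X) (at level 70, no associativity) : l2_scope.
Notation "~ p" := (fneg p) : l2_scope.
Notation "p /\ q" := (fconj p q) : l2_scope.
Notation "p \/ q" := (fdisj p q) : l2_scope.
Notation "p --> q" := (fimp p q) (at level 99, right associativity) : l2_scope.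
Notation "p <--> q" := (fiff p q) (at level 95, no associativity) : l2_scope.
Notation "'ALL' x .. y , p" := (alln (fun x => .. (alln (fun y => p)) ..))
  (at level 200, x binder, y binder, right associativity) : l2_scope.
Notation "'EX' x .. y , p" := (exn (fun x => .. (exn (fun y => p)) ..))
  (at level 200, x binder, y binder, right associativity) : l2_scope.
Notation "'ALLS' X .. Y , p" := (alls (fun X => .. (alls (fun Y => p)) ..))
  (at level 200, X binder, Y binder, right associativity) : l2_scope.
Notation "'EXS' X .. Y , p" := (exs (fun X => .. (exs (fun Y => p)) ..))
  (at level 200, X binder, Y binder, right associativity) : l2_scope.
Local Open Scope l2_scope.

(** * The theory RCA0 *)

Inductive Delta0 : form -> Prop :=
| D0_bot : Delta0 Bot
| D0_eq s t : Delta0 (Eq s t)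
| D0_lt s t : Delta0 (Lt s t)
| D0_mem t X : Delta0 (Mem t X)
| D0_imp p q : Delta0 p -> Delta0 q -> Delta0 (Imp p q)
| D0_ball t p : Delta0 p -> Delta0 (AllNum (Imp (Lt (tvar 0) (tlift t)) p)).

Inductive Sigma1 : form -> Prop :=
| S1_ex p : Delta0 p -> Sigma1 (ExNum p).

Inductive Pi1 : form -> Prop :=
| P1_all p : Delta0 p -> Pi1 (AllNum p).

Definition basic_axioms : list form := map close
  [ ALL m, ~ (m + one == zero);
    ALL m n, m + one == n + one --> m == n;
    ALL m, m + zero == m;
    ALL m n, m + (n + one) == (m + n) + one;
    ALL m, m * zero == zero;
    ALL m n, m * (n + one) == (m * n) + m;
    ALL m, ~ (m < zero);
    ALL m n, m < n + one <--> m < n \/ m == n ].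

(** In the two schemes number variable [0] is the variable of induction or
    comprehension; all other variables are parameters. *)
Definition induction (p : form) : form :=
  Imp (And (instN tzero p)
           (AllNum (Imp p (subst (scons (tadd (tvar 0) tone) (fun k => tvar (S k)))
                               (fun X => X) p))))
      (AllNum p).

Definition comprehension (p q : form) : form :=
  Imp (AllNum (Iff p q)) (ExSet (AllNum (Iff (Mem (tvar 0) 0) (liftS p)))).

Inductive RCA0 : form -> Prop :=
| RCA0_basic p : In p basic_axioms -> RCA0 p
| RCA0_induction p : Sigma1 p -> RCA0 (induction p)
| RCA0_comprehension p q : Sigma1 p -> Pi1 q -> RCA0 (comprehension p q).

(** * Functions *)

Definition npair (a b : tm) : tm := (a + b) * (a + b) + a.

(** [F] is the graph of a function on the natural numbers. Elements of [F] that are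
    not pairs play no role. *)
Definition is_fun (F : sv) : fm :=
  ALL i, EX j, ALL k, npair i k IN F <--> k == j.

(** * Rational numbers

    [Q a b c] stands for the rational (a - b) / (c + 1). A rational has several
    codes; no identification is needed, since the order below does not depend on
    the choice of codes. *)

Record qtm := Q { qpos : tm; qneg : tm; qaux : tm }.

Definition qden (q : qtm) : tm := qaux q + one.
Definition qcode (q : qtm) : tm := npair (npair (qpos q) (qneg q)) (qaux q).

Definition allq (P : qtm -> fm) : fm := ALL a b c, P (Q a b c).
Definition exq (P : qtm -> fm) : fm := EX a b c, P (Q a b c).

Definition qzero : qtm := Q zero zero zero.
Definition qopp (q : qtm) : qtm := Q (qneg q) (qpos q) (qaux q).
(** (c + 1) (d + 1) = (c * d + c + d) + 1 *)
Definition qadd (q r : qtm) : qtm :=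
  Q (qpos q * qden r + qpos r * qden q)
    (qneg q * qden r + qneg r * qden q)
    (qaux q * qaux r + qaux q + qaux r).
Definition qsub (q r : qtm) : qtm := qadd q (qopp r).

Definition qle (q r : qtm) : fm :=
  qpos q * qden r + qneg r * qden q <= qpos r * qden q + qneg q * qden r.
Definition qlt (q r : qtm) : fm :=
  qpos q * qden r + qneg r * qden q < qpos r * qden q + qneg q * qden r.

(** The formula [qabs q P] says that |q| satisfies [P]. *)
Definition qabs (q : qtm) (P : qtm -> fm) : fm :=
  (qle qzero q --> P q) /\ (qlt q qzero --> P (qopp q)).

Definition allqpos (P : qtm -> fm) : fm :=
  allq (fun e => qlt qzero e --> P e).

(** * Reals

    A sequence of rationals is handled through its entries: for [x : qseq], the
    formula [x i P] says that the [i]-th entry of [x] satisfies [P]. *)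

Definition qseq := tm -> (qtm -> fm) -> fm.

Definition qconst (q : qtm) : qseq := fun _ P => P q.
Definition xsub (x y : qseq) : qseq :=
  fun i P => x i (fun q => y i (fun r => P (qsub q r))).
Definition xabs (x : qseq) : qseq := fun i P => x i (fun q => qabs q P).

(** |x_i - y_j| < e *)
Definition qdist_lt (x : qseq) (i : tm) (y : qseq) (j : tm) (e : qtm) : fm :=
  x i (fun q => y j (fun r => qabs (qsub q r) (fun d => qlt d e))).

Definition xle (x y : qseq) : fm :=
  allqpos (fun e => EX N, ALL n, N <= n -->
    x n (fun q => y n (fun r => qle q (qadd r e)))).
Definition xeq (x y : qseq) : fm := xle x y /\ xle y x.
Definition xlt (x y : qseq) : fm := xle x y /\ ~ xeq x y.

(** [val_at X k]: the set [X], viewed as a graph, has exactly one value at [k],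
    and it is the code of a rational. *)
Definition val_at (X : sv) (k : tm) : fm :=
  exq (fun q => ALL j, npair k j IN X <--> j == qcode q).
Definition entry (X : sv) (k : tm) (P : qtm -> fm) : fm :=
  allq (fun q => npair k (qcode q) IN X --> P q).

Definition seq_of (X : sv) : qseq := entry X.
Definition row (X : sv) (n : tm) : qseq := fun i => entry X (npair n i).

Definition is_real (X : sv) : fm :=
  (ALL i, val_at X i) /\
  allqpos (fun e => EX N, ALL m n, N <= m --> N <= n -->
    qdist_lt (seq_of X) m (seq_of X) n e).

(** The value at [npair n i] is the [i]-th entry of the [n]-th real; the Cauchy
    condition is uniform in [n]. *)
Definition is_real_seq (X : sv) : fm :=
  (ALL n i, val_at X (npair n i)) /\
  allqpos (fun e => EX N, ALL n i j, N <= i --> N <= j -->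
    qdist_lt (row X n) i (row X n) j e).

(** * The principles *)

Definition infinite (P : tm -> fm) : fm := ALL k, EX i, k < i /\ P i.
Definition finite (P : tm -> fm) : fm := EX k, ALL i, P i --> i <= k.
Definition diff (P R : tm -> fm) : tm -> fm := fun i => P i /\ ~ R i.
Definition all_numbers : tm -> fm := fun i => i == i.
Definition elems (X : sv) : tm -> fm := fun i => i IN X.
Definition section (R : sv) (i : tm) : tm -> fm := fun n => npair n i IN R.

Definition IPP : fm :=
  ALL N, ALLS c,
    is_fun c /\ (ALL i j, npair i j IN c --> j <= N) -->
    EX n, n <= N /\ infinite (fun i => npair i n IN c).

Definition COH : fm :=
  ALLS R, EXS C,
    infinite (elems C) /\
    ALL i, finite (diff (elems C) (section R i)) \/
           finite (diff (elems C) (diff all_numbers (section R i))).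

Definition StCOH : fm := COH /\ IPP.

Definition bounded (X : sv) : fm :=
  EXS B, is_real B /\ ALL n, xle (xabs (row X n)) (seq_of B).

Definition strictly_increasing (F : sv) : fm :=
  ALL i j m n, i < j --> npair i m IN F --> npair j n IN F --> m < n.

Definition subseq_converges (X F : sv) : fm :=
  EXS x, is_real x /\
    allqpos (fun e => EX N, ALL i m, N <= i --> npair i m IN F -->
      xlt (xabs (xsub (row X m) (seq_of x))) (qconst e)).

Definition BW : fm :=
  ALLS X, is_real_seq X /\ bounded X -->
    EXS F, is_fun F /\ strictly_increasing F /\ subseq_converges X F.

(* Main.v *)
(** By Goedel's completeness theorem it is enough to prove the equivalence in every
    structure satisfying RCA0, arguing with unrestricted classical logic about the
    structure but using induction and comprehension only for predicates that are
    Sigma_1, respectively Delta_1, in parameters from it. The codes of rationals in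
    such a structure make up an ordered field, in which all estimates take place.

    StCOH implies BW: let [C] be cohesive for the sets [{n | x_n,i < q}], enumerated
    increasingly by [f]. For fixed [i], IPP picks a cell of a fine grid that contains
    [x_(f k),i] for infinitely many [k], hence by cohesiveness for almost all [k]; so
    [x_(f k),i] is Cauchy in [k]. As the double sequence is uniformly Cauchy, the
    diagonal [z_k = x_(f k),k] is a real, and [x_(f k)] converges to it.

    BW implies IPP: a convergent subsequence of a bounded sequence of natural numbers
    is eventually constant. BW implies COH: let [x_n] be the real whose ternary digits
    are the truth values of [n in R_i]. Digits 0 and 1 of two such reals agree as far as
    the reals are close, so the range of a convergent subsequence is cohesive. *)

(* The obstacle is that induction and comprehension accept only predicates of low complexity, while
   the mathematics concerns ordinary Rocq predicates. Definability is therefore a property [D0],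
   [S1] or [D1] of predicates on environments, proved by tactics that follow the shape of the
   predicate. Closure of Sigma_1 under bounded quantifiers is collection; recursive definitions
   (enumerating a set, summing digits) rest on coding finite sets by divisibility. Only rational
   entries x_n,i are compared with q, since comparison of reals without a rate of convergence is not
   Delta_1; the uniform Cauchy condition carries the result over to the reals. Cohesiveness gives
   each grid point a threshold after which the sequence stays on one side of it, but a grid of
   nonstandard size may lack a common threshold; IPP singles out one cell, and then two thresholds
   suffice. Base 3 leaves a gap: digits 0 and 1 after place j add at most half of 3^-j, so different
   prefixes stay separated, which fails in base 2. *)
From HB Require Import structures.
From mathcomp Require Import all_boot all_order all_algebra boolp.
From mathcomp Require Import ring lra.
Require Import Defs.

Set Implicit Arguments.
Unset Strict Implicit.
Unset Printing Implicit Defensive.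

(** * Completeness *)

Arguments prv_axiom {T A p}.
Arguments prv_hyp {T A p}.
Arguments prv_impI {T A p q}.
Arguments prv_impE {T A p q}.
Arguments prv_raa {T A p}.
Arguments prv_allNI {T A p}.
Arguments prv_allNE {T A p}.
Arguments prv_allSI {T A p}.
Arguments prv_allSE {T A p}.
Arguments prv_refl {T A}.
Arguments prv_eq {T A p s t}.

Section Quotient.

Variables (T : Type) (R : T -> T -> Prop).
Hypotheses (R_refl : forall t, R t t) (R_sym : forall s t, R s t -> R t s).
Hypothesis R_trans : forall s t u, R s t -> R t u -> R s u.

(** A class is a predicate, so equivalent elements get equal classes by extensionality. The
    construction serves both the term model and the field of fractions. *)
Definition quot := {P : T -> Prop | exists t, P = R t}.
Definition cls (t : T) : quot := exist _ (R t) (ex_intro _ t erefl).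
Definition rep (d : quot) : T := sval (cid (svalP d)).

Lemma repK d : cls (rep d) = d.
Proof.
by case: d => P HP; apply: eq_exist; rewrite /rep /=; case: cid.
Qed.

Lemma cls_eqP s t : cls s = cls t <-> R s t.
Proof.
split=> [[E]|Rst]; first by rewrite E; exact: R_refl.
apply: eq_exist; apply: funext => u; apply: propext; split.
  by apply/R_trans/R_sym.
exact: R_trans.
Qed.

Lemma rep_cls t : R (rep (cls t)) t.
Proof. by apply/cls_eqP; rewrite repK. Qed.

End Quotient.

(** * Substitution calculus *)

Definition up (f : nat -> term) : nat -> term :=
  scons (tvar 0) (fun k => tlift (f k)).
Definition upS (g : nat -> nat) : nat -> nat := scons 0 (fun k => S (g k)).

Lemma tsubst_comp f g t :
  tsubst f (tsubst g t) = tsubst (fun k => tsubst f (g k)) t.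
Proof. by elim: t => //= s -> t ->. Qed.

Lemma tsubst_id t : tsubst tvar t = t.
Proof. by elim: t => //= s -> t ->. Qed.

Lemma tlift_tsubst f t : tlift (tsubst f t) = tsubst (up f) (tlift t).
Proof. by rewrite /tlift !tsubst_comp. Qed.

Lemma subst_comp p f1 g1 f2 g2 :
  subst f2 g2 (subst f1 g1 p) =
  subst (fun k => tsubst f2 (f1 k)) (fun X => g2 (g1 X)) p.
Proof.
elim: p f1 g1 f2 g2 => [|s t|s t|t X|p IHp q IHq|p IH|p IH] f1 g1 f2 g2 //=.
- by rewrite !tsubst_comp.
- by rewrite !tsubst_comp.
- by rewrite tsubst_comp.
- by rewrite IHp IHq.
- rewrite IH; congr (AllNum (subst _ _ p)); apply: funext => -[|k] //=.
  by rewrite -/(up f2) -tlift_tsubst.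
- by rewrite IH; congr (AllSet (subst _ _ p)); apply: funext => -[|k].
Qed.

Lemma subst_id p : subst tvar (fun X => X) p = p.
Proof.
have upid : up tvar = tvar by apply: funext => -[|k].
have upSid : upS (fun X => X) = (fun X => X) by apply: funext => -[|k].
elim: p => [|s t|s t|t X|p IHp q IHq|p IH|p IH] //=; rewrite ?tsubst_id //.
- by rewrite IHp IHq.
- by rewrite -/(up tvar) upid IH.
- by rewrite -/(upS (fun X => X)) upSid IH.
Qed.

Lemma subst_instN f g t p :
  subst f g (instN t p) = instN (tsubst f t) (subst (up f) g p).
Proof.
rewrite /instN !subst_comp; congr (subst _ _ p); apply: funext => -[|k] //=.
by rewrite /tlift tsubst_comp /= tsubst_id.
Qed.

Lemma subst_instS f g X p :
  subst f g (instS X p) = instS (g X) (subst f (upS g) p).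
Proof.
rewrite /instS !subst_comp; congr (subst _ _ p); apply: funext => -[|k] //=;
  by rewrite ?tsubst_id.
Qed.

Lemma subst_scons f g t p :
  subst (scons t f) g p = instN t (subst (up f) g p).
Proof.
rewrite /instN subst_comp; congr (subst _ _ p); apply: funext => -[|k] //=.
by rewrite /tlift tsubst_comp tsubst_id.
Qed.

Lemma subst_sconsS f g X p :
  subst f (scons X g) p = instS X (subst f (upS g) p).
Proof.
rewrite /instS subst_comp; congr (subst _ _ p); apply: funext => -[|k] //=;
  by rewrite ?tsubst_id.
Qed.

Lemma liftN_subst f g p : liftN (subst f g p) = subst (up f) g (liftN p).
Proof. by rewrite /liftN !subst_comp. Qed.

Lemma liftS_subst f g p : liftS (subst f g p) = subst f (upS g) (liftS p).
Proof.
rewrite /liftS !subst_comp; congr (subst _ _ p); apply: funext => k /=.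
by rewrite tsubst_id.
Qed.

(** * Admissible rules: substitution, weakening, generalisation *)

Section Derivations.

Variable T : form -> Prop.
Hypothesis T_subst : forall p f g, T p -> T (subst f g p).

(** Axioms are not shifted by the eigenvariable rules, so the axiom case needs [T] itself to be
    closed under substitution. *)
Lemma prv_subst A p f g :
  prv T A p -> prv T (List.map (subst f g) A) (subst f g p).
Proof.
move=> H; elim: H f g => {A p}.
- by move=> A p Tp f g; apply/prv_axiom/T_subst.
- by move=> A p Ap f g; apply/prv_hyp/List.in_map.
- by move=> A p q _ IH f g; apply: prv_impI; exact: IH.
- by move=> A p q _ IHp _ IHq f g; apply: prv_impE (IHp f g) (IHq f g).
- by move=> A p _ IH f g; apply: prv_raa; exact: IH.
- move=> A p _ IH f g /=; apply: prv_allNI; move: (IH (up f) g).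
  rewrite !List.map_map; under eq_fun do rewrite -liftN_subst.
  by [].
- by move=> A p t _ IH f g; rewrite subst_instN; apply/prv_allNE/IH.
- move=> A p _ IH f g /=; apply: prv_allSI; move: (IH f (upS g)).
  rewrite !List.map_map; under eq_fun do rewrite -liftS_subst.
  by [].
- by move=> A p X _ IH f g; rewrite subst_instS; apply/prv_allSE/IH.
- by move=> A t f g; apply: prv_refl.
- move=> A p s t _ IHe _ IHp f g; rewrite subst_instN.
  by apply: prv_eq (IHe f g) _; rewrite -subst_instN.
Qed.

Lemma prv_weaken A B p : prv T A p -> List.incl A B -> prv T B p.
Proof.
move=> H; elim: H B => {A p}.
- by move=> A p Tp B _; apply: prv_axiom.
- by move=> A p Ap B /(_ p Ap); apply: prv_hyp.
- move=> A p q _ IH B AB; apply/prv_impI/IH => r /= [->|/AB]; by [left|right].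
- by move=> A p q _ IHp _ IHq B AB; apply: prv_impE (IHp B AB) (IHq B AB).
- move=> A p _ IH B AB; apply/prv_raa/IH => r /= [->|/AB]; by [left|right].
- by move=> A p _ IH B AB; apply/prv_allNI/IH/List.incl_map.
- by move=> A p t _ IH B AB; apply/prv_allNE/IH.
- by move=> A p _ IH B AB; apply/prv_allSI/IH/List.incl_map.
- by move=> A p X _ IH B AB; apply/prv_allSE/IH.
- by move=> A t B _; apply: prv_refl.
- by move=> A p s t _ IHe _ IHp B AB; apply: prv_eq (IHe B AB) (IHp B AB).
Qed.

Lemma prv_botE A p : prv T A Bot -> prv T A p.
Proof. by move=> H; apply: prv_raa; apply: prv_weaken H _ => q; right. Qed.

(** All free variables of both sorts lie below [b], expressed through substitutions because this is
    how the bound gets applied. *)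
Definition free_below b p := forall f f' g g',
  (forall k, k < b -> f k = f' k) -> (forall k, k < b -> g k = g' k) ->
  subst f g p = subst f' g' p.

Lemma tsubst_bound t : exists b, forall f f',
  (forall k, k < b -> f k = f' k) -> tsubst f t = tsubst f' t.
Proof.
elim: t => [k|||s [b Hb] t [c Hc]|s [b Hb] t [c Hc]] /=; try by exists 0.
- by exists k.+1 => f f'; apply.
- exists (maxn b c) => f f' ff'.
  by rewrite (Hb f f') ?(Hc f f') // => k kb; apply: ff'; rewrite leq_max kb ?orbT.
- exists (maxn b c) => f f' ff'.
  by rewrite (Hb f f') ?(Hc f f') // => k kb; apply: ff'; rewrite leq_max kb ?orbT.
Qed.

Lemma free_below_ex p : exists b, free_below b p.
Proof.
elim: p => [|s t|s t|t X|p [b Hb] q [c Hc]|p [b Hb]|p [b Hb]] /=.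
- by exists 0.
- have [b Hb] := tsubst_bound (tadd s t); exists b => f f' g g' ff' _ /=.
  by case: (Hb f f' ff') => -> ->.
- have [b Hb] := tsubst_bound (tadd s t); exists b => f f' g g' ff' _ /=.
  by case: (Hb f f' ff') => -> ->.
- have [b Hb] := tsubst_bound t; exists (maxn b X.+1) => f f' g g' ff' gg' /=.
  rewrite (Hb f f') ?gg' // ?leq_max ?leqnn ?orbT // => k kb.
  by apply: ff'; rewrite leq_max kb.
- exists (maxn b c) => f f' g g' ff' gg' /=.
  by rewrite (Hb f f' g g') ?(Hc f f' g g') // => k kb;
    rewrite ?ff' ?gg' // leq_max kb ?orbT.
- exists b => f f' g g' ff' gg' /=; congr AllNum; apply: Hb => // -[|k] //= kb.
  by rewrite ff' // ltnW.
- exists b => f f' g g' ff' gg' /=; congr AllSet; apply: Hb => // -[|k] //= kb.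
  by rewrite gg' // ltnW.
Qed.

Lemma free_below_list A : exists b, forall p, List.In p A -> free_below b p.
Proof.
elim: A => [|p A [b Hb]]; first by exists 0.
have [c Hc] := free_below_ex p; exists (maxn b c) => q /= [<-|Aq] f f' g g' ff' gg'.
  by apply: Hc => k kc; rewrite ?ff' ?gg' // leq_max kc orbT.
by apply: (Hb q Aq) => k kb; rewrite ?ff' ?gg' // leq_max kb.
Qed.

(** The term [t] is a fresh variable, and derivability at a fresh variable generalises. For a
    refuted universal formula the same [t] becomes the Henkin witness. *)
Lemma prv_generalizeN A p : exists t, prv T A (instN t p) -> prv T A (AllNum p).
Proof.
have [b Hb] := free_below_list (p :: A).
exists (tvar b) => H; apply: prv_allNI.
(* Sends the fresh variable to index 0 and shifts the others, so that [A] becomes its lift and the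
   instance becomes [p] again. *)
pose f k := if k == b then tvar 0 else tvar k.+1.
have := prv_subst f (fun X => X) H.
have -> : List.map (subst f (fun X => X)) A = List.map liftN A.
  apply: List.map_ext_in => q Aq; apply: Hb => //; first by right.
  by move=> k; rewrite /f; case: eqP => // ->; rewrite ltnn.
rewrite /instN subst_comp (Hb p _ _ tvar _ (fun X => X)) ?subst_id //; first by left.
by move=> [|k] /=; rewrite /f ?eqxx // => kb; rewrite ltn_eqF // ltnW.
Qed.

Lemma prv_generalizeS A p : exists X, prv T A (instS X p) -> prv T A (AllSet p).
Proof.
have [b Hb] := free_below_list (p :: A).
exists b => H; apply: prv_allSI.
pose g k := if k == b then 0 else k.+1.
have := prv_subst tvar g H.
have -> : List.map (subst tvar g) A = List.map liftS A.
  apply: List.map_ext_in => q Aq; apply: Hb => //; first by right.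
  by move=> k; rewrite /g; case: eqP => // ->; rewrite ltnn.
rewrite /instS subst_comp (Hb p _ _ tvar _ (fun X => X)) ?subst_id //; first by left.
by move=> [|k] /=; rewrite /g ?eqxx // => kb; rewrite ltn_eqF // ltnW.
Qed.

End Derivations.

(** * Enumeration of all formulas *)

Import GenTree.

Fixpoint tencode (t : term) : tree nat :=
  match t with
  | tvar k => Leaf k
  | tzero => Node 0 [::]
  | tone => Node 1 [::]
  | tadd s t => Node 2 [:: tencode s; tencode t]
  | tmul s t => Node 3 [:: tencode s; tencode t]
  end.

Fixpoint tdecode (x : tree nat) : term :=
  match x with
  | Leaf k => tvar k
  | Node 0 _ => tzero
  | Node 2 [:: s; t] => tadd (tdecode s) (tdecode t)
  | Node 3 [:: s; t] => tmul (tdecode s) (tdecode t)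
  | _ => tone
  end.

Lemma tencodeK : cancel tencode tdecode.
Proof. by elim=> //= s -> t ->. Qed.

Fixpoint fencode (p : form) : tree nat :=
  match p with
  | Bot => Node 0 [::]
  | Eq s t => Node 1 [:: tencode s; tencode t]
  | Lt s t => Node 2 [:: tencode s; tencode t]
  | Mem t X => Node 3 [:: tencode t; Leaf X]
  | Imp p q => Node 4 [:: fencode p; fencode q]
  | AllNum p => Node 5 [:: fencode p]
  | AllSet p => Node 6 [:: fencode p]
  end.

Fixpoint fdecode (x : tree nat) : form :=
  match x with
  | Node 1 [:: s; t] => Eq (tdecode s) (tdecode t)
  | Node 2 [:: s; t] => Lt (tdecode s) (tdecode t)
  | Node 3 [:: t; Leaf X] => Mem (tdecode t) X
  | Node 4 [:: p; q] => Imp (fdecode p) (fdecode q)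
  | Node 5 [:: p] => AllNum (fdecode p)
  | Node 6 [:: p] => AllSet (fdecode p)
  | _ => Bot
  end.

Lemma fencodeK : cancel fencode fdecode.
Proof. by elim=> //= [s t|s t|t X|p -> q ->|p ->|p ->] //; rewrite ?tencodeK. Qed.

Definition form_enum (n : nat) : form :=
  if unpickle n is Some x then fdecode x else Bot.

Lemma form_enum_surj p : exists n, form_enum n = p.
Proof. by exists (pickle (fencode p)); rewrite /form_enum pickleK fencodeK. Qed.

Record structure := Structure {
  num : Type;
  sets : Type;
  mzero : num;
  mone : num;
  madd : num -> num -> num;
  mmul : num -> num -> num;
  mlt : num -> num -> Prop;
  mmem : num -> sets -> Prop }.

Fixpoint tval (M : structure) (e : nat -> num M) (t : term) : num M :=
  match t with
  | tvar k => e k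
  | tzero => mzero M
  | tone => mone M
  | tadd s t => madd (tval e s) (tval e t)
  | tmul s t => mmul (tval e s) (tval e t)
  end.

Fixpoint sat (M : structure) (e : nat -> num M) (s : nat -> sets M) (p : form) : Prop :=
  match p with
  | Bot => False
  | Eq t u => tval e t = tval e u
  | Lt t u => mlt (tval e t) (tval e u)
  | Mem t X => mmem (tval e t) (s X)
  | Imp p q => sat e s p -> sat e s q
  | AllNum p => forall x, sat (scons x e) s p
  | AllSet p => forall X, sat e (scons X s) p
  end.

(** * Maximal consistent sets with witnesses *)

Section Henkin.

Variable T : form -> Prop.
Hypothesis T_subst : forall p f g, T p -> T (subst f g p).

Definition consistent A := ~ prv T A Bot.

(** Existential quantifiers are abbreviations, so witnesses are needed only for refuted universal
    formulas. *)
Definition decides p B :=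
  List.In p B \/
  [/\ List.In (Not p) B,
      forall q, p = AllNum q -> exists t, List.In (Not (instN t q)) B &
      forall q, p = AllSet q -> exists X, List.In (Not (instS X q)) B].

(** No new constants are introduced for the witnesses: contexts are finite lists, so a fresh
    variable always exists. *)
Lemma consistent_extend A p : consistent A ->
  exists B, [/\ consistent B, List.incl A B & decides p B].
Proof.
move=> cA; have [cpA|ncpA] := lem (consistent (p :: A)).
  by exists (p :: A); split=> //; [move=> q; right | left; left].
have {}ncpA : prv T A (Not p) by apply: prv_impI; apply: contrapT.
have cNp : consistent (Not p :: A).
  by move=> H; apply: cA; apply: prv_impE ncpA _; apply: prv_raa.
(* If [Not q] were inconsistent with [Not p], then [q] and hence, by generalisation, the universal
   formula [p] would follow from [Not p]. *)
have witness q : (prv T (Not p :: A) q -> prv T (Not p :: A) p) ->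
    consistent [:: Not q, Not p & A].
  move=> qp H; apply: cNp; apply: prv_impE (qp (prv_raa H)).
  by apply: prv_hyp; left.
have incl1 : List.incl A (Not p :: A) by move=> q; right.
have incl2 q : List.incl A [:: q, Not p & A] by move=> r; right; right.
case: p cNp witness incl1 incl2 {ncpA} => [|s t|s t|t X|p q|p|p] cNp witness incl1 incl2.
1-5: by eexists; split; [exact: cNp | | right; split => //; left].
- have [t Ht] := prv_generalizeN T_subst (Not (AllNum p) :: A) p.
  exists [:: Not (instN t p), Not (AllNum p) & A]; split=> //.
    exact: witness.
  right; split => // [|q [<-]]; first by right; left.
  by exists t; left.
- have [X HX] := prv_generalizeS T_subst (Not (AllSet p) :: A) p.
  exists [:: Not (instS X p), Not (AllSet p) & A]; split=> //.
    exact: witness.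
  right; split => // [|q [<-]]; first by right; left.
  by exists X; left.
Qed.

Record henkin_set (G : form -> Prop) : Prop := HenkinSet {
  henkin_bot : ~ G Bot;
  henkin_prv : forall A p, (forall q, List.In q A -> G q) -> prv T A p -> G p;
  henkin_imp : forall p q, (G p -> G q) -> G (Imp p q);
  henkin_allN : forall p, (forall t, G (instN t p)) -> G (AllNum p);
  henkin_allS : forall p, (forall X, G (instS X p)) -> G (AllSet p) }.

(** Stage [n + 1] of the chain decides formula number [n]. A derivation uses finitely many
    hypotheses, so an inconsistency of the union [G] would already occur at some stage. *)
Lemma henkin_ex A0 : consistent A0 ->
  exists2 G, henkin_set G & forall p, List.In p A0 -> G p.
Proof.
move=> cA0.
have ext (x : nat * {A | consistent A}) : {y : {A | consistent A} |
    List.incl (sval x.2) (sval y) /\ decides (form_enum x.1) (sval y)}.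
  apply: cid; case: x => n [A cA] /=.
  by have [B [cB AB dB]] := consistent_extend (form_enum n) cA; exists (exist _ B cB).
pose chain := fix chain n := if n is m.+1 then sval (ext (m, chain m))
                             else exist _ A0 cA0.
have chainS n : List.incl (sval (chain n)) (sval (chain n.+1)).
  by case: (svalP (ext (n, chain n))).
have chain_le m n : m <= n -> List.incl (sval (chain m)) (sval (chain n)).
  elim: n => [|n IH]; first by rewrite leqn0 => /eqP ->.
  rewrite leq_eqVlt => /orP[/eqP -> //|mn] p Hp; exact/chainS/IH.
pose G p := exists n, List.In p (sval (chain n)).
have sub A : (forall q, List.In q A -> G q) ->
    exists n, List.incl A (sval (chain n)).
  elim: A => [|p A IH] H; first by exists 0.
  have [q Aq|n Hn] := IH; first by apply: H; right.
  have [|m Hm] := H p; first by left.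
  exists (maxn m n) => q /= [<-|Aq].
    by apply: chain_le Hm; rewrite leq_maxl.
  by apply: chain_le (Hn q Aq); rewrite leq_maxr.
have Gbot : ~ G Bot.
  by move=> [n Hn]; apply: (svalP (chain n)); apply: prv_hyp.
have Gcon A : (forall q, List.In q A -> G q) -> consistent A.
  move=> /sub[n Hn] H; apply: (svalP (chain n)); exact: prv_weaken H Hn.
have Gdec p : G p \/ [/\ G (Not p),
    forall q, p = AllNum q -> exists t, G (Not (instN t q)) &
    forall q, p = AllSet q -> exists X, G (Not (instS X q))].
  have [n <-] := form_enum_surj p.
  have [_] := svalP (ext (n, chain n)); rewrite -[sval _]/(sval (chain n.+1)).
  case=> [H|[H HN HS]]; [left|right]; first by exists n.+1.
  split; first by exists n.+1.
    by move=> q /HN[t Ht]; exists t, n.+1.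
  by move=> q /HS[X HX]; exists X, n.+1.
have Gprv A p : (forall q, List.In q A -> G q) -> prv T A p -> G p.
  move=> GA Hp; have [//|[Gnp _ _]] := Gdec p.
  case: (Gcon (Not p :: A)); first by move=> q /= [<-//|]; exact: GA.
  apply: (prv_impE (p := p)); first by apply: prv_hyp; left.
  by apply: prv_weaken Hp _ => q; right.
have Gnot p : G p -> G (Not p) -> False.
  move=> Gp Gnp; apply: (Gcon [:: Not p; p]).
    by move=> q [<-|[<-|[]]].
  by apply: (prv_impE (p := p)); apply: prv_hyp; [left|right; left].
exists G; last by move=> p Hp; exists 0.
split=> //.
- move=> p q pq; have [/pq Gq|[Gnp _ _]] := Gdec p.
    apply: (Gprv [:: q]); first by move=> r [<-|[]].
    by apply: prv_impI; apply: prv_hyp; right; left.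
  apply: (Gprv [:: Not p]); first by move=> r [<-|[]].
  apply: prv_impI; apply: prv_botE; apply: (prv_impE (p := p)); apply: prv_hyp.
    by right; left.
  by left.
- move=> p Hp; have [//|[_ /(_ p erefl)[t Ht] _]] := Gdec (AllNum p).
  by case: (Gnot (instN t p)).
- move=> p Hp; have [//|[_ _ /(_ p erefl)[X HX]]] := Gdec (AllSet p).
  by case: (Gnot (instS X p)).
Qed.

(** * The term model and completeness *)

Section TermModel.

Variable G : form -> Prop.
Hypothesis henkinG : henkin_set G.

Lemma G_hyp1 p q : prv T [:: p] q -> G p -> G q.
Proof. by move=> H Gp; apply: (henkin_prv henkinG _ H) => r [<-|[]]. Qed.

Lemma G_eq p s t : G (Eq s t) -> G (instN s p) -> G (instN t p).
Proof.
move=> Hst Hp; apply: (henkin_prv henkinG (A := [:: Eq s t; instN s p])).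
  by move=> r [<-|[<-|[]]].
by apply: (prv_eq (s := s)); apply: prv_hyp; [left|right; left].
Qed.

Lemma G_refl t : G (Eq t t).
Proof. by apply: (henkin_prv henkinG (A := [::])) => //; exact: prv_refl. Qed.

Lemma instN_tlift s t : tsubst (scons s tvar) (tlift t) = t.
Proof. by rewrite /tlift tsubst_comp tsubst_id. Qed.

Lemma G_sym s t : G (Eq s t) -> G (Eq t s).
Proof.
move=> Hst; have := G_eq (p := Eq (tvar 0) (tlift s)) Hst.
by rewrite /instN /= !instN_tlift; apply; exact: G_refl.
Qed.

Lemma G_trans s t u : G (Eq s t) -> G (Eq t u) -> G (Eq s u).
Proof.
move=> Hst Htu; have := G_eq (p := Eq (tlift s) (tvar 0)) Htu.
by rewrite /instN /= !instN_tlift; apply.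
Qed.

Definition term_eq s t := G (Eq s t).
Definition term_num := quot term_eq.
Local Notation cls := (cls term_eq).

Lemma cls_term_eqP s t : cls s = cls t <-> G (Eq s t).
Proof. exact: (cls_eqP G_refl G_sym G_trans). Qed.

Lemma G_rep t : G (Eq (rep (cls t)) t).
Proof. exact: (rep_cls G_refl G_sym G_trans). Qed.

Lemma cls_tsubst v s t :
  G (Eq s t) -> cls (tsubst (scons s tvar) v) = cls (tsubst (scons t tvar) v).
Proof.
move=> Hst; apply/cls_term_eqP.
have := G_eq (p := Eq (tlift (tsubst (scons s tvar) v)) v) Hst.
by rewrite /instN /= !instN_tlift; apply; exact: G_refl.
Qed.

(** Only the number sort has an equality symbol, so the set variables themselves can serve as sets,
    without a quotient. *)
Definition term_model : structure := {|
  num := term_num;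
  sets := nat;
  mzero := cls tzero;
  mone := cls tone;
  madd d d' := cls (tadd (rep d) (rep d'));
  mmul d d' := cls (tmul (rep d) (rep d'));
  mlt d d' := G (Lt (rep d) (rep d'));
  mmem d X := G (Mem (rep d) X) |}.

Lemma tval_term_model f t :
  tval (M := term_model) (fun k => cls (f k)) t = cls (tsubst f t).
Proof.
elim: t => //= [s -> t ->|s -> t ->].
  have := cls_tsubst (tadd (tvar 0) (tlift (rep (cls (tsubst f t))))) (G_rep (tsubst f s)).
  have := cls_tsubst (tadd (tlift (tsubst f s)) (tvar 0)) (G_rep (tsubst f t)).
  by rewrite /= !instN_tlift => -> ->.
have := cls_tsubst (tmul (tvar 0) (tlift (rep (cls (tsubst f t))))) (G_rep (tsubst f s)).
have := cls_tsubst (tmul (tlift (tsubst f s)) (tvar 0)) (G_rep (tsubst f t)).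
by rewrite /= !instN_tlift => -> ->.
Qed.

Lemma G_rep_iff p t : G (instN (rep (cls t)) p) <-> G (instN t p).
Proof. by split; apply: G_eq; [exact: G_rep | apply/G_sym/G_rep]. Qed.

Lemma scons_cls t f : scons (cls t) (fun k => cls (f k)) = fun k => cls (scons t f k).
Proof. by apply: funext => -[]. Qed.

(** The truth lemma. Valuations are given by substitutions so that the induction passes under
    binders: each number of the domain is the class of a term, and this term extends the
    substitution. *)
Lemma sat_term_model p f g :
  sat (M := term_model) (fun k => cls (f k)) g p <-> G (subst f g p).
Proof.
elim: p f g => [|s t|s t|t X|p IHp q IHq|p IH|p IH] f g /=.
- by split=> // /(henkin_bot henkinG).
- by rewrite !tval_term_model cls_term_eqP.
- rewrite !tval_term_model; set s' := tsubst f s; set t' := tsubst f t.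
  have := G_rep_iff (Lt (tvar 0) (tlift (rep (cls t')))) s'.
  have := G_rep_iff (Lt (tlift s') (tvar 0)) t'.
  by rewrite /instN /= !instN_tlift => <- <-.
- rewrite !tval_term_model; exact: (G_rep_iff (Mem (tvar 0) (g X))).
- rewrite IHp IHq; split; first exact: (henkin_imp henkinG).
  move=> Gpq Gp; apply: (henkin_prv henkinG
    (A := [:: Imp (subst f g p) (subst f g q); subst f g p])).
    by move=> r [<-|[<-|[]]].
  by apply: (prv_impE (p := subst f g p)); apply: prv_hyp; [left|right; left].
- split=> [H|H d].
    apply: (henkin_allN henkinG) => t; rewrite -subst_scons -IH -scons_cls.
    exact: H.
  rewrite -(repK d) scons_cls IH subst_scons.
  by apply: G_hyp1 H; apply: prv_allNE; apply: prv_hyp; left.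
- split=> [H|H X].
    by apply: (henkin_allS henkinG) => X; rewrite -subst_sconsS -IH.
  rewrite IH subst_sconsS.
  by apply: G_hyp1 H; apply: prv_allSE; apply: prv_hyp; left.
Qed.

End TermModel.

Theorem completeness p :
  (forall M : structure, (forall q e s, T q -> sat (M := M) e s q) ->
     forall e s, sat (M := M) e s p) ->
  provable T p.
Proof.
move=> Hp; apply: contrapT => np.
have [|G hG Gp] := @henkin_ex [:: Not p].
  by move=> H; apply: np; apply: prv_raa.
(* Choosing representatives turns every valuation into a substitution; [T_subst] then puts every
   instance of an axiom into [G]. *)
have env (e : nat -> term_num G) : e = fun k => cls (term_eq G) (rep (e k)).
  by apply: funext => k; rewrite repK.
apply: (henkin_bot hG).
have : G (Not p) by apply: Gp; left.
have : sat (M := term_model G) (fun k => cls (term_eq G) (tvar k)) (fun k => k) p.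
  apply: Hp => q e s Tq; rewrite [e]env.
  apply/(sat_term_model hG); apply: (henkin_prv hG (A := [::])) => //.
  by apply/prv_axiom/T_subst.
move=> /(sat_term_model hG); rewrite subst_id => H H'.
apply: (henkin_prv hG (A := [:: Not p; p])).
  by move=> r [<-|[<-|[]]].
by apply: (prv_impE (p := p)); apply: prv_hyp; [left|right; left].
Qed.

End Henkin.

(** * Closure of RCA0 under substitution *)

Lemma Delta0_subst p f g : Delta0 p -> Delta0 (subst f g p).
Proof.
move=> H; elim: H f g => {p} /=; try by constructor.
by move=> t p _ IH f g; rewrite -/(up f) -tlift_tsubst; constructor.
Qed.

Lemma subst_induction p f g : subst f g (induction p) = induction (subst (up f) g p).
Proof.
rewrite /induction -[RHS]/(Imp (And (instN (tsubst f tzero) _) _) _).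
rewrite -subst_instN /= -/(up f); congr (Imp (And _ (AllNum (Imp _ _))) _).
rewrite !subst_comp; congr (subst _ _ p); apply: funext => -[|k] //=.
by rewrite /tlift !tsubst_comp.
Qed.

Lemma subst_comprehension p q f g :
  subst f g (comprehension p q) = comprehension (subst (up f) g p) (subst (up f) g q).
Proof. by rewrite /comprehension liftS_subst. Qed.

Lemma RCA0_subst p f g : RCA0 p -> RCA0 (subst f g p).
Proof.
case=> {}p.
- move=> H; suff -> : subst f g p = p by exact: RCA0_basic.
  (* The eight basic axioms are closed, so substitution leaves each of them unchanged by
     computation. *)
  by move: H => /=; do 8 (case=> [<- //|]).
- case=> {}p Dp; rewrite subst_induction; apply: RCA0_induction => /=.
  by constructor; apply: Delta0_subst.
- move=> q [{}p Dp] [{}q Dq]; rewrite subst_comprehension.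
  by apply: RCA0_comprehension => /=; constructor; apply: Delta0_subst.
Qed.

(** * Definability in a model *)

(* Without the element [rca_set] there would be no valuation, so that a structure
   without sets would satisfy every axiom vacuously. *)
Record rca_model := RcaModel {
  rca_structure :> structure;
  rca_set : sets rca_structure;
  rca_axioms : forall q e s, RCA0 q -> sat (M := rca_structure) e s q }.

Lemma tval_subst (M : structure) (e : nat -> num M) f t :
  tval e (tsubst f t) = tval (fun k => tval e (f k)) t.
Proof. by elim: t => //= s -> t ->. Qed.

Lemma sat_subst (M : structure) p (e : nat -> num M) s f g :
  sat e s (subst f g p) <-> sat (fun k => tval e (f k)) (fun X => s (g X)) p.
Proof.
elim: p e s f g => [|t u|t u|t X|p IHp q IHq|p IH|p IH] e s f g //=.
- by rewrite !tval_subst.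
- by rewrite !tval_subst.
- by rewrite tval_subst.
- by rewrite IHp IHq.
- have E x : (fun k => tval (scons x e) (up f k)) = scons x (fun k => tval e (f k)).
    by apply: funext => -[|k] //=; rewrite /tlift tval_subst.
  by split=> H x; move: (H x); rewrite -/(up f) IH E.
- have E X : (fun k => scons X s (upS g k)) = scons X (fun k => s (g k)).
    by apply: funext => -[|k].
  by split=> H x; move: (H x); rewrite -/(upS g) IH E.
Qed.

Section Connectives.

Variables (M : structure) (e : nat -> num M) (s : nat -> sets M).

Lemma sat_And p q : sat e s (And p q) <-> sat e s p /\ sat e s q.
Proof. by rewrite /=; have [] := lem (sat e s p); have [] := lem (sat e s q); tauto. Qed.

Lemma sat_Iff p q : sat e s (Iff p q) <-> (sat e s p <-> sat e s q).
Proof. exact: sat_And. Qed.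

Lemma sat_ExNum p : sat e s (ExNum p) <-> exists x, sat (scons x e) s p.
Proof.
split=> /= [H|[x Hx] H]; last exact: H Hx.
by apply: contrapT => nH; apply: H => x Hx; apply: nH; exists x.
Qed.

Lemma sat_ExSet p : sat e s (ExSet p) <-> exists X, sat e (scons X s) p.
Proof.
split=> /= [H|[X HX] H]; last exact: H HX.
by apply: contrapT => nH; apply: H => X HX; apply: nH; exists X.
Qed.

End Connectives.

Lemma sat_liftS (M : structure) (e : nat -> num M) s X p :
  sat e (scons X s) (liftS p) <-> sat e s p.
Proof. exact: sat_subst. Qed.

Lemma sat_instN (M : structure) (e : nat -> num M) s t p :
  sat e s (instN t p) <-> sat (scons (tval e t) e) s p.
Proof.
rewrite /instN sat_subst.
by have -> : (fun k => tval e (scons t tvar k)) = scons (tval e t) e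
  by apply: funext => -[].
Qed.

Arguments S1_ex {p}.
Arguments P1_all {p}.
Arguments RCA0_comprehension {p q}.
Arguments RCA0_induction {p}.

(* Even indices carry the free variables of a definable predicate, odd indices its
   parameters. *)
Definition mix (A : Type) (e r : nat -> A) (k : nat) : A :=
  if odd k then r k./2 else e k./2.

Lemma mix_even (A : Type) (e r : nat -> A) k : mix e r k.*2 = e k.
Proof. by rewrite /mix odd_double doubleK. Qed.

Lemma mix_odd (A : Type) (e r : nat -> A) k : mix e r k.*2.+1 = r k.
Proof. by rewrite /mix /= odd_double /= uphalf_double. Qed.

Lemma even_or_odd k : (exists j, k = j.*2) \/ (exists j, k = j.*2.+1).
Proof.
by rewrite -[k]odd_double_half; case: odd; [right|left]; exists k./2.
Qed.

Section Definability.

Variable M : rca_model.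
Let N := num M.
Let env := nat -> N.

(** Definability with parameters: [r] here, and [r] and [s] for predicates below, may be any
    elements of the model, so constants and fixed sets are always definable. *)
Definition term_def (F : env -> N) :=
  exists t r, forall e, tval (mix e r) t = F e.

Definition D0 (P : env -> Prop) :=
  exists p r s, Delta0 p /\ forall e, sat (mix e r) s p <-> P e.

Lemma D0_iff P Q : (forall e, P e <-> Q e) -> D0 P -> D0 Q.
Proof.
by move=> PQ [p [r [s [Dp Hp]]]]; exists p, r, s; split=> // e; rewrite Hp.
Qed.

(** Two definable predicates can be combined only over a common parameter list. The lists are
    interleaved as [mix r r'], and each formula is renamed to read its own half. *)
Lemma rename_left : exists f : nat -> nat, forall (e r r' : env) k,
  mix e (mix r r') (f k) = mix e r k.
Proof.
suff /choice[f Hf] : forall k, exists j, forall (e r r' : env),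
    mix e (mix r r') j = mix e r k by exists f.
move=> k; have [[j ->]|[j ->]] := even_or_odd k; [exists j.*2|exists j.*2.*2.+1];
  by move=> e r r'; rewrite ?mix_odd ?mix_even.
Qed.

Lemma rename_right : exists f : nat -> nat, forall (e r r' : env) k,
  mix e (mix r r') (f k) = mix e r' k.
Proof.
suff /choice[f Hf] : forall k, exists j, forall (e r r' : env),
    mix e (mix r r') j = mix e r' k by exists f.
move=> k; have [[j ->]|[j ->]] := even_or_odd k; [exists j.*2|exists j.*2.+1.*2.+1];
  by move=> e r r'; rewrite ?mix_odd ?mix_even.
Qed.

Lemma rename_scons : exists f : nat -> nat, forall x (e r : env) k,
  scons x (mix e r) (f k) = mix (scons x e) r k.
Proof.
suff /choice[f Hf] : forall k, exists j, forall x (e r : env),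
    scons x (mix e r) j = mix (scons x e) r k by exists f.
move=> k; have [[[|j] ->]|[j ->]] := even_or_odd k;
    [exists 0|exists j.*2.+1|exists j.*2.+2].
- by [].
- by move=> x e r; rewrite mix_even /= mix_even.
- by move=> x e r; rewrite mix_odd /= mix_odd.
Qed.

Lemma rename_scons2 : exists f : nat -> nat, forall y x (e r : env) k,
  scons y (scons x (mix e r)) (f k) = mix (scons y (scons x e)) r k.
Proof.
suff /choice[f Hf] : forall k, exists j, forall y x (e r : env),
    scons y (scons x (mix e r)) j = mix (scons y (scons x e)) r k by exists f.
move=> k; have [[[|[|j]] ->]|[j ->]] := even_or_odd k.
- by exists 0.
- by exists 1.
- by exists (j.*2.+2) => y x e r; rewrite mix_even /= mix_even.
- by exists (j.*2.+3) => y x e r; rewrite mix_odd /= mix_odd.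
Qed.

Lemma sat_rename (e e' : env) s g p (f : nat -> nat) :
  (forall k, e (f k) = e' k) ->
  sat e s (subst (fun k => tvar (f k)) g p) <-> sat e' (fun X => s (g X)) p.
Proof.
by move=> ee'; rewrite sat_subst /=; have -> : (fun k => e (f k)) = e' by apply: funext.
Qed.

Lemma term_def_merge F G : term_def F -> term_def G -> exists t u r,
  (forall e, tval (mix e r) t = F e) /\ (forall e, tval (mix e r) u = G e).
Proof.
move=> [t [r Ht]] [u [r' Hu]].
have [f Hf] := rename_left; have [g Hg] := rename_right.
exists (tsubst (fun k => tvar (f k)) t), (tsubst (fun k => tvar (g k)) u), (mix r r').
split=> e; rewrite tval_subst /=; [rewrite -Ht|rewrite -Hu];
  congr tval; apply: funext => k; [exact: Hf|exact: Hg].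
Qed.

Lemma D0_merge P Q : D0 P -> D0 Q -> exists p q r s,
  [/\ Delta0 p, Delta0 q, forall e, sat (mix e r) s p <-> P e &
      forall e, sat (mix e r) s q <-> Q e].
Proof.
move=> [p [r [s [Dp Hp]]]] [q [r' [s' [Dq Hq]]]].
have [f Hf] := rename_left; have [g Hg] := rename_right.
exists (subst (fun k => tvar (f k)) double p).
exists (subst (fun k => tvar (g k)) (fun X => X.*2.+1) q), (mix r r'), (mix s s').
split; try exact: Delta0_subst.
  move=> e; rewrite (sat_rename (e' := mix e r)) //.
  by under eq_fun do rewrite mix_even.
move=> e; rewrite (sat_rename (e' := mix e r')) //.
by under eq_fun do rewrite mix_odd.
Qed.

Lemma D0_term_merge P F : D0 P -> term_def F -> exists p t r s,
  [/\ Delta0 p, forall e, sat (mix e r) s p <-> P e &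
      forall e, tval (mix e r) t = F e].
Proof.
move=> [p [r [s [Dp Hp]]]] [t [r' Ht]].
have [f Hf] := rename_left; have [g Hg] := rename_right.
exists (subst (fun k => tvar (f k)) (fun X => X) p), (tsubst (fun k => tvar (g k)) t).
exists (mix r r'), s; split; first exact: Delta0_subst.
  by move=> e; rewrite (sat_rename (e' := mix e r)).
by move=> e; rewrite tval_subst /= -Ht; congr tval; apply: funext => k; exact: Hg.
Qed.

Lemma term_def_var k : term_def (fun e => e k).
Proof. by exists (tvar k.*2), (fun=> mzero M) => e /=; rewrite mix_even. Qed.

Lemma term_def_const c : term_def (fun=> c).
Proof. by exists (tvar 1), (fun=> c) => e. Qed.

Lemma term_def_add F G :
  term_def F -> term_def G -> term_def (fun e => madd (F e) (G e)).
Proof.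
move=> HF HG; have [t [u [r [Ht Hu]]]] := term_def_merge HF HG.
by exists (tadd t u), r => e /=; rewrite Ht Hu.
Qed.

Lemma term_def_mul F G :
  term_def F -> term_def G -> term_def (fun e => mmul (F e) (G e)).
Proof.
move=> HF HG; have [t [u [r [Ht Hu]]]] := term_def_merge HF HG.
by exists (tmul t u), r => e /=; rewrite Ht Hu.
Qed.

Lemma D0_eq F G : term_def F -> term_def G -> D0 (fun e => F e = G e).
Proof.
move=> HF HG; have [t [u [r [Ht Hu]]]] := term_def_merge HF HG.
exists (Eq t u), r, (fun=> rca_set M).
by split=> [|e /=]; [constructor|rewrite Ht Hu].
Qed.

Lemma D0_lt F G : term_def F -> term_def G -> D0 (fun e => mlt (F e) (G e)).
Proof.
move=> HF HG; have [t [u [r [Ht Hu]]]] := term_def_merge HF HG.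
exists (Lt t u), r, (fun=> rca_set M).
by split=> [|e /=]; [constructor|rewrite Ht Hu].
Qed.

Lemma D0_mem F X : term_def F -> D0 (fun e => mmem (F e) X).
Proof.
move=> [t [r Ht]]; exists (Mem t 0), r, (fun=> X).
by split=> [|e /=]; [constructor|rewrite Ht].
Qed.

Lemma D0_imp P Q : D0 P -> D0 Q -> D0 (fun e => P e -> Q e).
Proof.
move=> HP HQ; have [p [q [r [s [Dp Dq Hp Hq]]]]] := D0_merge HP HQ.
exists (Imp p q), r, s.
by split=> [|e /=]; [constructor|rewrite Hp Hq].
Qed.

Lemma D0_false : D0 (fun=> False).
Proof.
by exists Bot, (fun=> mzero M), (fun=> rca_set M); split=> //; constructor.
Qed.

Lemma D0_not P : D0 P -> D0 (fun e => ~ P e).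
Proof. by move=> HP; apply: D0_imp D0_false. Qed.

Lemma D0_or P Q : D0 P -> D0 Q -> D0 (fun e => P e \/ Q e).
Proof.
move=> HP HQ; apply: D0_iff (D0_imp (D0_not HP) HQ) => e.
by have [] := lem (P e); tauto.
Qed.

Lemma D0_and P Q : D0 P -> D0 Q -> D0 (fun e => P e /\ Q e).
Proof.
move=> HP HQ; apply: D0_iff (D0_not (D0_imp HP (D0_not HQ))) => e.
by have [] := lem (P e); have [] := lem (Q e); tauto.
Qed.

Lemma sconsE (e : env) : scons (e 0) (fun k => e k.+1) = e.
Proof. by apply: funext => -[]. Qed.

(** [P] takes the bound variable separately from the environment, as it occurs in a Rocq quantifier,
    so that the definability tactics can apply the lemma by matching. *)
Lemma D0_ball F (P : N -> env -> Prop) : term_def F ->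
  D0 (fun e => P (e 0) (fun k => e k.+1)) ->
  D0 (fun e => forall x, mlt x (F e) -> P x e).
Proof.
move=> HF HP; have [p [t [r [s [Dp Hp Ht]]]]] := D0_term_merge HP HF.
have [f Hf] := rename_scons.
exists (AllNum (Imp (Lt (tvar 0) (tlift t)) (subst (fun k => tvar (f k)) (fun X => X) p))).
exists r, s; split=> [|e /=]; first by constructor; apply: Delta0_subst.
split=> H x; move: (H x); rewrite /tlift tval_subst /= Ht.
  by rewrite (sat_rename (e' := mix (scons x e) r)) // Hp.
by rewrite (sat_rename (e' := mix (scons x e) r)) // Hp.
Qed.

Lemma D0_bex F (P : N -> env -> Prop) : term_def F ->
  D0 (fun e => P (e 0) (fun k => e k.+1)) ->
  D0 (fun e => exists x, mlt x (F e) /\ P x e).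
Proof.
move=> HF HP; have := D0_not (D0_ball (P := fun x e => ~ P x e) HF (D0_not HP)).
apply: D0_iff => e; split=> [H|[x [xF Px]] H]; last exact: H Px.
apply: contrapT => H'; apply: H => x xF Px; apply: H'; by exists x.
Qed.

(** Where [g] is [None], the variable is frozen at a parameter of the model. *)
Lemma D0_subst (g : nat -> option nat) (t : env) P : D0 P ->
  D0 (fun e => P (fun k => if g k is Some j then e j else t k)).
Proof.
move=> [p [r [s [Dp Hp]]]].
have /choice[f Hf] k : exists j, forall e : env, mix e (mix r t) j =
    mix (fun k => if g k is Some j then e j else t k) r k.
  have [[j ->]|[j ->]] := even_or_odd k; last first.
    by exists j.*2.*2.+1 => e; rewrite !mix_odd mix_even.
  case gj : (g j) => [i|]; [exists i.*2 => e|exists j.*2.+1.*2.+1 => e].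
    by rewrite !mix_even gj.
  by rewrite !(mix_even, mix_odd) gj.
exists (subst (fun k => tvar (f k)) (fun X => X) p), (mix r t), s.
split=> [|e]; first exact: Delta0_subst.
by rewrite (sat_rename (e' := mix (fun k => if g k is Some j then e j else t k) r)).
Qed.

Lemma D0_rename f P : D0 P -> D0 (fun e => P (fun k => e (f k))).
Proof. exact: (D0_subst (fun k => Some (f k)) (fun=> mzero M)). Qed.

Definition S1 (P : env -> Prop) :=
  exists2 Q, D0 Q & forall e, P e <-> exists x, Q (scons x e).

Lemma S1_iff P Q : (forall e, P e <-> Q e) -> S1 P -> S1 Q.
Proof. by move=> PQ [R DR HR]; exists R => // e; rewrite -PQ. Qed.

Lemma S1_rename f P : S1 P -> S1 (fun e => P (fun k => e (f k))).
Proof.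
move=> [Q DQ HQ]; pose g k := if k is j.+1 then (f j).+1 else 0.
exists (fun e => Q (fun k => e (g k))); first exact: D0_rename.
move=> e; rewrite HQ.
have E x : scons x (fun k => e (f k)) = fun k => scons x e (g k).
  by apply: funext => -[|k].
by split=> -[x Hx]; exists x; move: Hx; rewrite E.
Qed.

Lemma S1_D0 P : D0 P -> S1 P.
Proof.
move=> DP; exists (fun e => P (fun k => e k.+1)); first exact: D0_rename.
by move=> e; split=> [?|[]//]; exists (mzero M).
Qed.

(** The Pi_1 formula demanded by the scheme is the negation of the Sigma_1 formula that defines the
    complement. *)
Lemma comprehension_model (P : N -> Prop) :
  S1 (fun e => P (e 0)) -> S1 (fun e => ~ P (e 0)) ->
  exists X : sets M, forall x, mmem x X <-> P x.
Proof.
move=> [Q DQ HQ] [R DR HR].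
have [q [q' [r [s [Dq Dq' Hq Hq']]]]] := D0_merge DQ DR.
have [g Hg] := rename_scons2.
pose ren := subst (fun k => tvar (g k)) (fun X => X).
have sat_ren x y c p : sat (scons y (scons x (mix c r))) s (ren p) <->
    sat (mix (scons y (scons x c)) r) s p by apply: sat_rename.
have Dren p : Delta0 p -> Delta0 (ren p) by apply: Delta0_subst.
have Dn : Delta0 (Not (ren q')) by constructor; [exact: Dren|constructor].
pose c : env := fun=> mzero M.
have compr : (forall x, sat (scons x (mix c r)) s
      (Iff (ExNum (ren q)) (AllNum (Not (ren q'))))) ->
    sat (mix c r) s (ExSet (AllNum (Iff (Mem (tvar 0) 0) (liftS (ExNum (ren q)))))).
  exact: rca_axioms (RCA0_comprehension (S1_ex (Dren _ Dq)) (P1_all Dn)).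
have sat_q x : sat (scons x (mix c r)) s (ExNum (ren q)) <-> P x.
  rewrite sat_ExNum (HQ (scons x c)).
  by split=> -[y]; rewrite ?sat_ren ?Hq => Hy; exists y; rewrite ?sat_ren ?Hq.
suff /compr/sat_ExSet[X HX] : forall x, sat (scons x (mix c r)) s
    (Iff (ExNum (ren q)) (AllNum (Not (ren q')))).
  exists X => x; have : sat (scons x (mix c r)) (scons X s)
    (Iff (Mem (tvar 0) 0) (liftS (ExNum (ren q)))) by exact: HX.
  by rewrite sat_Iff sat_liftS sat_q.
move=> x; rewrite sat_Iff sat_q /=.
have := HR (scons x c); rewrite /= => HRx; split=> [Px y|H].
  by rewrite sat_ren Hq' => Ry; apply: HRx.2 => //; exists y.
by apply: contrapT => /HRx[y Ry]; apply: (H y); rewrite sat_ren Hq'.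
Qed.

Lemma induction_model (P : N -> Prop) : S1 (fun e => P (e 0)) ->
  P (mzero M) -> (forall x, P x -> P (madd x (mone M))) -> forall x, P x.
Proof.
move=> [Q [q [r [s [Dq Hq]]]] HQ] P0 PS x.
have [g Hg] := rename_scons2.
pose ren := subst (fun k => tvar (g k)) (fun X => X).
have Dren p : Delta0 p -> Delta0 (ren p) by apply: Delta0_subst.
have sat_ren y x' c p : sat (scons y (scons x' (mix c r))) s (ren p) <->
    sat (mix (scons y (scons x' c)) r) s p by apply: sat_rename.
pose c : env := fun=> mzero M.
have sat_q y : sat (scons y (mix c r)) s (ExNum (ren q)) <-> P y.
  rewrite sat_ExNum (HQ (scons y c)).
  by split=> -[z]; rewrite ?sat_ren ?Hq => Hz; exists z; rewrite ?sat_ren ?Hq.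
set q' := ExNum (ren q); pose q1 := subst (scons (tadd (tvar 0) tone)
  (fun k => tvar k.+1)) (fun X => X) q'.
have sat_q1 y : sat (scons y (mix c r)) s q1 <-> P (madd y (mone M)).
  rewrite sat_subst -sat_q; suff -> : (fun k => tval (scons y (mix c r))
    (scons (tadd (tvar 0) tone) (fun k => tvar k.+1) k)) =
    scons (madd y (mone M)) (mix c r) by [].
  by apply: funext => -[].
have ind : sat (mix c r) s (And (instN tzero q') (AllNum (Imp q' q1))) ->
    sat (mix c r) s (AllNum q').
  exact: rca_axioms (RCA0_induction (S1_ex (Dren _ Dq))).
apply/sat_q; apply: ind; rewrite sat_And sat_instN sat_q; split=> //.
by move=> y /sat_q/PS/sat_q1.
Qed.

End Definability.

(** * Arithmetic in a model *)

Ltac solve_term_def :=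
  cbn beta;
  lazymatch goal with
  | |- term_def (fun e => madd (@?F e) (@?G e)) =>
      apply: (term_def_add (F := F) (G := G)); solve_term_def
  | |- term_def (fun e => mmul (@?F e) (@?G e)) =>
      apply: (term_def_mul (F := F) (G := G)); solve_term_def
  | |- term_def (fun e => e ?k) => exact: (term_def_var _ k)
  | _ => exact: term_def_const
  end.

Ltac solve_D0 :=
  cbn beta;
  lazymatch goal with
  | |- D0 (fun e => @?F e = @?G e) =>
      apply: (D0_eq (F := F) (G := G)); solve_term_def
  | |- D0 (fun e => mlt (@?F e) (@?G e)) =>
      apply: (D0_lt (F := F) (G := G)); solve_term_def
  | |- D0 (fun e => mmem (@?F e) ?X) =>
      apply: (D0_mem (F := F) X); solve_term_def
  | |- D0 (fun e => ~ @?P e) => apply: (D0_not (P := P)); solve_D0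
  | |- D0 (fun e => forall x, mlt x (@?F e) -> @?P x e) =>
      apply: (D0_ball (F := F) (P := P)); [solve_term_def|solve_D0]
  | |- D0 (fun e => exists x, mlt x (@?F e) /\ @?P x e) =>
      apply: (D0_bex (F := F) (P := P)); [solve_term_def|solve_D0]
  | |- D0 (fun e => @?P e /\ @?Q e) => apply: (D0_and (P := P) (Q := Q)); solve_D0
  | |- D0 (fun e => @?P e \/ @?Q e) => apply: (D0_or (P := P) (Q := Q)); solve_D0
  | |- D0 (fun e => @?P e -> @?Q e) => apply: (D0_imp (P := P) (Q := Q)); solve_D0
  end.

Section PeanoArithmetic.

Variable M : rca_model.
Let N := num M.
Implicit Types x y z : N.

Local Notation "0" := (mzero M).
Local Notation "1" := (mone M).
Local Notation "x + y" := (madd x y).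
Local Notation "x * y" := (mmul x y).
Local Notation "x < y" := (mlt x y).

Let e0 : nat -> N := fun=> 0.
Let s0 : nat -> sets M := fun=> rca_set M.
Let basic q : List.In q basic_axioms -> sat e0 s0 q.
Proof. by move=> Hq; exact/rca_axioms/RCA0_basic. Qed.

Lemma maddS_neq0 x : x + 1 <> 0.
Proof. exact: (basic (or_introl erefl)). Qed.

Lemma maddS_inj x y : x + 1 = y + 1 -> x = y.
Proof. exact: (basic (or_intror (or_introl erefl))). Qed.

Lemma maddx0 x : x + 0 = x.
Proof. exact: (basic (or_intror (or_intror (or_introl erefl)))). Qed.

Lemma maddxS x y : x + (y + 1) = (x + y) + 1.
Proof. exact: (basic (or_intror (or_intror (or_intror (or_introl erefl))))). Qed.

Lemma mmulx0 x : x * 0 = 0.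
Proof. exact: (basic (or_intror (or_intror (or_intror (or_intror (or_introl erefl)))))). Qed.

Lemma mmulxS x y : x * (y + 1) = (x * y) + x.
Proof. exact: (basic (or_intror (or_intror (or_intror (or_intror (or_intror (or_introl erefl))))))). Qed.

Lemma mltx0 x : ~ x < 0.
Proof. exact: (basic (or_intror (or_intror (or_intror (or_intror (or_intror (or_intror (or_introl erefl)))))))). Qed.

Lemma mltxS x y : x < y + 1 <-> x < y \/ x = y.
Proof.
have : sat (scons y (scons x e0)) s0 (Iff (Lt (tvar 1) (tadd (tvar 0) tone))
    (Or (Lt (tvar 1) (tvar 0)) (Eq (tvar 1) (tvar 0)))).
  exact: (basic (or_intror (or_intror (or_intror (or_intror (or_intror (or_intror (or_intror (or_introl erefl)))))))) x y).
rewrite sat_Iff /= => ->.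
by have [] := lem (x < y); tauto.
Qed.

Ltac ind x := elim/induction_model: x => [||x IH]; first by apply: S1_D0; solve_D0.

Lemma madd0x x : 0 + x = x.
Proof. by ind x; rewrite ?maddx0 // maddxS IH. Qed.

Lemma maddSx x y : (x + 1) + y = (x + y) + 1.
Proof. by ind y; rewrite ?maddx0 // !maddxS IH. Qed.

Lemma maddC x y : x + y = y + x.
Proof. by ind y; rewrite ?maddx0 ?madd0x // maddxS maddSx IH. Qed.

Lemma maddA x y z : x + (y + z) = (x + y) + z.
Proof. by ind z; rewrite ?maddx0 // !maddxS IH. Qed.

Lemma mmul0x x : 0 * x = 0.
Proof. by ind x; rewrite ?mmulx0 // mmulxS IH maddx0. Qed.

Lemma mmulSx x y : (x + 1) * y = x * y + y.
Proof.
ind y; rewrite ?mmulx0 ?maddx0 // !mmulxS IH !maddA; congr (_ + 1).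
by rewrite -!maddA (maddC y).
Qed.

Lemma mmulC x y : x * y = y * x.
Proof. by ind y; rewrite ?mmulx0 ?mmul0x // mmulxS mmulSx IH. Qed.

Lemma mmulDr x y z : x * (y + z) = x * y + x * z.
Proof. by ind z; rewrite ?mmulx0 ?maddx0 // maddxS !mmulxS IH maddA. Qed.

Lemma mmulA x y z : x * (y * z) = (x * y) * z.
Proof. by ind z; rewrite ?mmulx0 // !mmulxS mmulDr IH. Qed.

Lemma maddIx x y z : x + z = y + z -> x = y.
Proof. by ind z; rewrite ?maddx0 // !maddxS => /maddS_inj. Qed.

Lemma mlt_ex x y : x < y <-> exists z, (x + z) + 1 = y.
Proof.
have lt0S z : 0 < z + 1.
  by ind z; rewrite mltxS ?madd0x; [right|left].
have ltS u v : u < v -> u + 1 < v + 1.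
  ind v; first by move=> /mltx0.
  rewrite !mltxS => -[/IH|->]; [rewrite mltxS|]; tauto.
split; last first.
  move=> [z <-]; ind z; first by rewrite maddx0 mltxS; right.
  by rewrite mltxS maddxS; left.
(* Bounding the witness makes the induction predicate Delta_0, the only kind that [ind] handles. *)
suff H : x < y -> exists z, z < y /\ (x + z) + 1 = y by move=> /H[z [_]]; exists z.
ind y; first by move=> /mltx0.
rewrite mltxS => -[/IH[z [zy xz]]|->]; last by exists 0; rewrite maddx0.
by exists (z + 1); split; [exact: ltS|rewrite maddxS xz].
Qed.

Lemma mlt_total x y : x < y \/ x = y \/ y < x.
Proof.
ind y.
  have [->|[z <-]] : x = 0 \/ exists z, z + 1 = x.
  - suff [->|[z [_ <-]]] : x = 0 \/ exists z, z < x /\ z + 1 = x;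
      [by left|by right; exists z|].
    ind x; [by left|right; exists x; split=> //; rewrite mltxS; by right].
  - by right; left.
  - by right; right; apply/mlt_ex; exists z; rewrite madd0x.
case: IH => [xy|[->|/mlt_ex[z <-]]].
- by left; rewrite mltxS; left.
- by left; rewrite mltxS; right.
- right; have [->|[w <-]] : z = 0 \/ exists w, w + 1 = z.
    suff [->|[w [_ <-]]] : z = 0 \/ exists w, w < z /\ w + 1 = z;
      [by left|by right; exists w|].
    ind z; [by left|right; exists z; split=> //; rewrite mltxS; by right].
  by left; rewrite maddx0.
  by right; apply/mlt_ex; exists w; rewrite maddSx maddxS.
Qed.

End PeanoArithmetic.

(** * The commutative semiring of numbers of a model *)

HB.instance Definition _ (M : rca_model) := gen_eqMixin (num M).
HB.instance Definition _ (M : rca_model) := gen_choiceMixin (num M).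
HB.instance Definition _ (M : rca_model) :=
  GRing.isNmodule.Build (num M) (@maddA M) (@maddC M) (@madd0x M).
Fact mmul1x (M : rca_model) : left_id (mone M) (@mmul M).
Proof. by move=> x; rewrite -[mone M]madd0x mmulSx mmul0x madd0x. Qed.
Fact mmulDl (M : rca_model) : left_distributive (@mmul M) (@madd M).
Proof. by move=> x y z; rewrite mmulC mmulDr !(mmulC z). Qed.
Fact mone_neq0 (M : rca_model) : mone M != mzero M.
Proof. by apply/eqP; rewrite -[mone M]madd0x; exact: maddS_neq0. Qed.
HB.instance Definition _ (M : rca_model) :=
  GRing.Nmodule_isComNzSemiRing.Build (num M)
   (@mmulA M) (@mmulC M) (@mmul1x M) (@mmulDl M) (@mmul0x M) (@mone_neq0 M).

(** * The ordered field of rationals of a model *)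

Import Order.TTheory GRing.Theory Num.Theory.
Local Open Scope ring_scope.

Notation "x <! y" := (mlt x y) (at level 70, no associativity).

Section Fractions.

Variable M : rca_model.
Let N := num M.
Implicit Types x y z : N.

Lemma ltm_ex x y : x <! y <-> exists z, x + z + 1 = y.
Proof. exact: mlt_ex. Qed.

Lemma addmI x y z : x + z = y + z -> x = y.
Proof. exact: maddIx. Qed.

Lemma addm1_neq0 x : x + 1 <> 0.
Proof. exact: maddS_neq0. Qed.

Lemma mulmI x y z : x * (z + 1) = y * (z + 1) -> x = y.
Proof.
have key (u w : N) : u * (z + 1) <> (u + w + 1) * (z + 1).
  (* The two sides differ by (w + 1) (z + 1), which is the successor of this number and so not
     zero. *)
  move=> E; apply: (@addm1_neq0 (w * z + w + z)); apply: (@addmI _ _ (u * (z + 1))).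
  by rewrite add0r [RHS]E; ring.
have [/ltm_ex[w <-] E|[//|/ltm_ex[w <-] E]] := mlt_total x y.
  by case: (key x w).
by case: (key y w).
Qed.

(* [(a, b, c)] stands for [(a - b) / (c + 1)]. *)
Definition ratio : Type := N * N * N.
Implicit Types q r : ratio.

Definition ratio_eq q r :=
  q.1.1 * (r.2 + 1) + r.1.2 * (q.2 + 1) = r.1.1 * (q.2 + 1) + q.1.2 * (r.2 + 1).

Lemma ratio_refl q : ratio_eq q q.
Proof. by []. Qed.

Lemma ratio_sym q r : ratio_eq q r -> ratio_eq r q.
Proof. by move=> E; rewrite /ratio_eq -E. Qed.

Lemma ratio_trans r q s : ratio_eq q r -> ratio_eq r s -> ratio_eq q s.
Proof.
case: q r s => [[a b] c] [[a' b'] c'] [[a2 b2] c2]; rewrite /ratio_eq /= => E F.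
(* Clears the middle denominator [c' + 1] and replaces a subtraction by adding a multiple of [b'] to
   both sides. *)
apply: (@mulmI _ _ c'); apply: (@addmI _ _ (b' * (c + 1) * (c2 + 1))).
transitivity ((a * (c' + 1) + b' * (c + 1)) * (c2 + 1) + b2 * (c + 1) * (c' + 1)).
  by ring.
rewrite E; transitivity ((a' * (c2 + 1) + b2 * (c' + 1)) * (c + 1) +
  b * (c' + 1) * (c2 + 1)); first by ring.
by rewrite F; ring.
Qed.

Definition frac := quot ratio_eq.
Local Notation cls := (cls ratio_eq).

Lemma clsP q r : cls q = cls r <-> ratio_eq q r.
Proof. exact: (cls_eqP ratio_refl ratio_sym (fun s t u => @ratio_trans t s u)). Qed.

Lemma fracP (k : frac) : exists q, k = cls q.
Proof. by exists (rep k); rewrite repK. Qed.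

(** Follows the object-level [qadd] literally, so that satisfaction of a formula unfolds to these
    terms; the last entry is (c + 1) (d + 1) - 1. *)
Definition radd q r : ratio :=
  (q.1.1 * (r.2 + 1) + r.1.1 * (q.2 + 1), q.1.2 * (r.2 + 1) + r.1.2 * (q.2 + 1),
   q.2 * r.2 + q.2 + r.2).
Definition ropp q : ratio := (q.1.2, q.1.1, q.2).
Definition rmul q r : ratio :=
  (q.1.1 * r.1.1 + q.1.2 * r.1.2, q.1.1 * r.1.2 + q.1.2 * r.1.1,
   q.2 * r.2 + q.2 + r.2).

Definition fadd (k l : frac) : frac := cls (radd (rep k) (rep l)).
Definition fopp (k : frac) : frac := cls (ropp (rep k)).
Definition fmul (k l : frac) : frac := cls (rmul (rep k) (rep l)).
Definition fzero : frac := cls (0, 0, 0).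
Definition fone : frac := cls (1, 0, 0).

Lemma rep_ratio q : ratio_eq (rep (cls q)) q.
Proof. exact: (rep_cls ratio_refl ratio_sym (fun s t u => @ratio_trans t s u)). Qed.

Lemma raddC q r : radd q r = radd r q.
Proof. by rewrite /radd; congr (_, _, _); ring. Qed.

Lemma rmulC q r : rmul q r = rmul r q.
Proof. by rewrite /rmul; congr (_, _, _); ring. Qed.

(** Compatibility in one argument ([key]) is enough because [radd] is commutative. *)
Lemma faddE q r : fadd (cls q) (cls r) = cls (radd q r).
Proof.
have key t t' s : ratio_eq t t' -> ratio_eq (radd t s) (radd t' s).
  case: t t' s {q r} => [[a b] c] [[a' b'] c'] [[a2 b2] c2].
  rewrite /ratio_eq /radd /= => E.
  transitivity ((c2 + 1) * (c2 + 1) * (a * (c' + 1) + b' * (c + 1)) +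
    (c + 1) * (c' + 1) * (c2 + 1) * (a2 + b2)); first by ring.
  by rewrite E; ring.
apply/clsP; apply: (@ratio_trans (radd q (rep (cls r)))).
  exact/key/rep_ratio.
by rewrite !(raddC q); exact/key/rep_ratio.
Qed.

Lemma fmulE q r : fmul (cls q) (cls r) = cls (rmul q r).
Proof.
have key t t' s : ratio_eq t t' -> ratio_eq (rmul t s) (rmul t' s).
  case: t t' s {q r} => [[a b] c] [[a' b'] c'] [[a2 b2] c2].
  rewrite /ratio_eq /rmul /= => E.
  transitivity ((c2 + 1) * (a2 * (a * (c' + 1) + b' * (c + 1)) +
    b2 * (a' * (c + 1) + b * (c' + 1)))); first by ring.
  by rewrite E -{2}E; ring.
apply/clsP; apply: (@ratio_trans (rmul q (rep (cls r)))).
  exact/key/rep_ratio.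
by rewrite !(rmulC q); exact/key/rep_ratio.
Qed.

Lemma foppE q : fopp (cls q) = cls (ropp q).
Proof.
apply/clsP; move: (rep (cls q)) (rep_ratio q) => q'.
case: q q' => [[a b] c] [[a' b'] c']; rewrite /ratio_eq /ropp /= => E.
by rewrite addrC -E addrC.
Qed.

Lemma faddA : associative fadd.
Proof.
move=> k l m; have [q ->] := fracP k; have [r ->] := fracP l; have [s ->] := fracP m.
by rewrite !faddE; apply/clsP; rewrite /ratio_eq /radd /=; ring.
Qed.

Lemma faddC : commutative fadd.
Proof. by move=> k l; rewrite /fadd raddC. Qed.

Lemma fadd0 : left_id fzero fadd.
Proof.
move=> k; have [q ->] := fracP k.
by rewrite /fzero faddE; apply/clsP; rewrite /ratio_eq /radd /=; ring.
Qed.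

Lemma faddN : left_inverse fzero fopp fadd.
Proof.
move=> k; have [q ->] := fracP k.
by rewrite foppE faddE; apply/clsP; rewrite /ratio_eq /radd /=; ring.
Qed.

Lemma fmulA : associative fmul.
Proof.
move=> k l m; have [q ->] := fracP k; have [r ->] := fracP l; have [s ->] := fracP m.
by rewrite !fmulE; apply/clsP; rewrite /ratio_eq /rmul /=; ring.
Qed.

Lemma fmulC : commutative fmul.
Proof. by move=> k l; rewrite /fmul rmulC. Qed.

Lemma fmul1 : left_id fone fmul.
Proof.
move=> k; have [q ->] := fracP k.
by rewrite /fone fmulE; apply/clsP; rewrite /ratio_eq /rmul /=; ring.
Qed.

Lemma fmulDl : left_distributive fmul fadd.
Proof.
move=> k l m; have [q ->] := fracP k; have [r ->] := fracP l; have [s ->] := fracP m.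
by rewrite !(faddE, fmulE); apply/clsP; rewrite /ratio_eq /radd /rmul /=; ring.
Qed.

Lemma fone_neq0 : fone != fzero :> {classic frac}.
Proof.
apply/eqP => /clsP; rewrite /ratio_eq /= => E; apply: (@addm1_neq0 0).
transitivity (1 * (0 + 1) + 0 * (0 + 1) : N); first by ring.
by rewrite E; ring.
Qed.

Lemma fmul_inv_ex (k : frac) : k <> fzero -> exists l, fmul l k = fone.
Proof.
have [[[a b] c] ->] := fracP k => k0.
have [/ltm_ex[z E]|[E|/ltm_ex[z E]]] := mlt_total a b.
(* Here a - b = -(z + 1), so the inverse is -(c + 1) / (z + 1). *)
- exists (cls (0, c + 1, z)); rewrite fmulE; apply/clsP.
  by rewrite /ratio_eq /rmul /= -E; ring.
- by case: k0; apply/clsP; rewrite /ratio_eq /= E; ring.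
- exists (cls (c + 1, 0, z)); rewrite fmulE; apply/clsP.
  by rewrite /ratio_eq /rmul /= -E; ring.
Qed.

Definition finv (k : frac) : frac :=
  if pselect (k <> fzero) is left k0 then sval (cid (fmul_inv_ex k0)) else fzero.

Lemma fmulV (k : frac) : k <> fzero -> fmul (finv k) k = fone.
Proof. by move=> k0; rewrite /finv; case: pselect => // p; case: cid. Qed.

Lemma finv0 : finv fzero = fzero.
Proof. by rewrite /finv; case: pselect. Qed.

Definition nonneg (k : frac) := exists z, (rep k).1.1 = (rep k).1.2 + z.

Lemma nonnegE q : nonneg (cls q) <-> exists z, q.1.1 = q.1.2 + z.
Proof.
suff key r s : ratio_eq r s -> (exists z, r.1.1 = r.1.2 + z) -> exists z, s.1.1 = s.1.2 + z.
  split; apply: key; first exact: rep_ratio.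
  exact/ratio_sym/rep_ratio.
case: r s => [[a b] c] [[a' b'] c']; rewrite /ratio_eq /= => E [z za].
have [/ltm_ex[w wb]|[->|/ltm_ex[w <-]]] := mlt_total a' b'.
- case: (@addm1_neq0 (z * (c' + 1) + w * c + w + c)).
  apply: (@addmI _ _ (a' * (c + 1) + b * (c' + 1))).
  by rewrite add0r -[RHS]E za -wb; ring.
- by exists 0; rewrite addr0.
- by exists (w + 1); ring.
Qed.

End Fractions.

HB.instance Definition _ (M : rca_model) := gen_eqMixin (frac M).
HB.instance Definition _ (M : rca_model) := gen_choiceMixin (frac M).
HB.instance Definition _ (M : rca_model) := GRing.isZmodule.Build (frac M)
  (@faddA M) (@faddC M) (@fadd0 M) (@faddN M).
HB.instance Definition _ (M : rca_model) := GRing.Zmodule_isComNzRing.Build (frac M)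
  (@fmulA M) (@fmulC M) (@fmul1 M) (@fmulDl M) (@fone_neq0 M).
Fact fmulVf (M : rca_model) (k : frac M) : k != 0 -> finv k * k = 1.
Proof. by move=> /eqP; exact: fmulV. Qed.
HB.instance Definition _ (M : rca_model) := GRing.ComNzRing_isField.Build (frac M)
  (@fmulVf M) (@finv0 M).

Section FractionOrder.

Variable M : rca_model.
Implicit Types k l : frac M.

Definition fle k l := `[< nonneg (l - k) >].
Definition fnorm k := if fle 0 k then k else - k.

Lemma fle0 q : fle 0 (cls (@ratio_eq M) q) <-> exists z, q.1.1 = q.1.2 + z.
Proof. by rewrite /fle subr0; split=> [/asboolP/nonnegE|/nonnegE/asboolP]. Qed.

Lemma fsub_ge0 k l : fle 0 (l - k) = fle k l.
Proof. by rewrite /fle subr0. Qed.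

Lemma fle0_add k l : fle 0 k -> fle 0 l -> fle 0 (k + l).
Proof.
have [q ->] := fracP k; have [r ->] := fracP l.
rewrite -[_ + _]/(fadd _ _) faddE !fle0 /= => -[z ->] [w ->].
by exists (z * (r.2 + 1) + w * (q.2 + 1)); ring.
Qed.

Lemma fle0_mul k l : fle 0 k -> fle 0 l -> fle 0 (k * l).
Proof.
have [q ->] := fracP k; have [r ->] := fracP l.
rewrite -[_ * _]/(fmul _ _) fmulE !fle0 /= => -[z ->] [w ->].
by exists (z * w); ring.
Qed.

Lemma fle_opp k : fle k 0 = fle 0 (- k).
Proof. by rewrite -[RHS]fsub_ge0 -fsub_ge0 sub0r subr0. Qed.

Lemma fle0_anti k : fle 0 k -> fle k 0 -> k = 0.
Proof.
rewrite fle_opp; have [[[a b] c] ->] := fracP k.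
rewrite -[- _]/(fopp _) foppE !fle0 /= => -[z za] [w wb].
apply/clsP; rewrite /ratio_eq /=.
have [/ltm_ex[u E]|[->|/ltm_ex[u E]]] := mlt_total a b; last 2 first.
- by ring.
- case: (@addm1_neq0 _ (u + w)); apply: (@addmI _ _ _ b).
  by rewrite add0r {2}wb -E; ring.
case: (@addm1_neq0 _ (u + z)); apply: (@addmI _ _ _ a).
by rewrite add0r {2}za -E; ring.
Qed.

Lemma fle0_total k : fle 0 k || fle k 0.
Proof.
rewrite fle_opp; have [[[a b] c] ->] := fracP k.
rewrite -[- _]/(fopp _) foppE; apply/orP; rewrite !fle0 /=.
have [/ltm_ex[u <-]|[->|/ltm_ex[u <-]]] := mlt_total a b.
- by right; exists (u + 1); ring.
- by left; exists 0; ring.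
- by left; exists (u + 1); ring.
Qed.

Lemma fnormN k : fnorm (- k) = fnorm k.
Proof.
rewrite /fnorm -fle_opp opprK; case: ifP => k1; case: ifP => k2 //.
  by rewrite (fle0_anti k2 k1) oppr0.
by have := fle0_total k; rewrite k1 k2.
Qed.

Lemma fge0_norm k : fle 0 k -> fnorm k = k.
Proof. by rewrite /fnorm => ->. Qed.

End FractionOrder.

HB.instance Definition _ (M : rca_model) := Num.IntegralDomain_isLeReal.Build (frac M)
  (@fle0_add M) (@fle0_mul M) (@fle0_anti M) (@fsub_ge0 M) (@fle0_total M)
  (@fnormN M) (@fge0_norm M) (fun _ _ => erefl).

Section Embedding.

Variable M : rca_model.
Implicit Types x y z : num M.

(** Inequalities between numbers are transported along [emb] to the ordered field, where [lra] and
    [nra] apply. *)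
Definition emb x : frac M := cls (@ratio_eq M) (x, 0, 0).

Lemma emb0 : emb 0 = 0. Proof. by []. Qed.
Lemma emb1 : emb 1 = 1. Proof. by []. Qed.

Lemma embD x y : emb (x + y) = emb x + emb y.
Proof.
rewrite -[RHS]/(fadd _ _) faddE; apply/clsP; rewrite /ratio_eq /radd /=; ring.
Qed.

Lemma embM x y : emb (x * y) = emb x * emb y.
Proof.
rewrite -[RHS]/(fmul _ _) fmulE; apply/clsP; rewrite /ratio_eq /rmul /=; ring.
Qed.

Lemma emb_ge0 x : 0 <= emb x.
Proof. by apply/fle0; exists x; rewrite /= add0r. Qed.

Lemma emb_lt x y : x <! y <-> emb x < emb y.
Proof.
have key u v : u <! v -> emb u < emb v.
  by move=> /ltm_ex[z <-]; rewrite !embD emb1; have := emb_ge0 z; lra.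
split=> [|xy]; first exact: key.
have [//|[E|/key]] := mlt_total x y; last by lra.
by move: xy; rewrite E ltxx.
Qed.

Lemma emb_inj x y : emb x = emb y -> x = y.
Proof.
move=> E; have [/emb_lt|[//|/emb_lt]] := mlt_total x y; by rewrite E ltxx.
Qed.

(** Discreteness of the numbers, which the field order alone does not provide to the arithmetic
    tactics. *)
Lemma emb_leS x y : x <! y -> emb x + 1 <= emb y.
Proof. by move=> /ltm_ex[z <-]; rewrite !embD emb1; have := emb_ge0 z; lra. Qed.

Lemma frac_val (k : frac M) : exists a b c, k = (emb a - emb b) / (emb c + 1).
Proof.
have [[[a b] c] ->] := fracP k; exists a, b, c.
have c1 : emb c + 1 != 0 by have := emb_ge0 c; lra.
apply: (mulIf c1); rewrite divfK //.
rewrite -emb1 -embD -[_ - _]/(fadd _ (fopp _)) foppE -[_ * _]/(fmul _ _) faddE fmulE.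
by apply/clsP; rewrite /ratio_eq /=; ring.
Qed.

End Embedding.

(** * Sigma_1 collection *)

Ltac solve_term_def ::=
  cbn beta;
  lazymatch goal with
  | |- term_def (fun e => madd (@?F e) (@?G e)) =>
      apply: (term_def_add (F := F) (G := G)); solve_term_def
  | |- term_def (fun e => @?F e + @?G e) =>
      apply: (term_def_add (F := F) (G := G)); solve_term_def
  | |- term_def (fun e => mmul (@?F e) (@?G e)) =>
      apply: (term_def_mul (F := F) (G := G)); solve_term_def
  | |- term_def (fun e => @?F e * @?G e) =>
      apply: (term_def_mul (F := F) (G := G)); solve_term_def
  | |- term_def (fun e => e ?k) => exact: (term_def_var _ k)
  | _ => exact: term_def_const
  end.

Ltac emb_facts :=
  repeat match goal with
  | H : ?x <! ?y |- _ => apply emb_leS in H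
  | H : ~ (?x <! ?y) |- _ => rewrite emb_lt in H; move/negP: H; rewrite -leNgt => H
  | H : ?x = ?y |- _ => apply (congr1 (@emb _)) in H
  | |- ?x <! ?y => apply/emb_lt
  | |- ?x = ?y => apply: emb_inj
  | |- ~ _ => let H := fresh "H" in intro H
  end;
  repeat match goal with
  | H : context [emb ?t] |- _ =>
      lazymatch t with
      | ?x + ?y => rewrite (embD x y) in H
      | ?x * ?y => rewrite (embM x y) in H
      | 1 => rewrite emb1 in H
      | 0 => rewrite emb0 in H
      end
  | |- context [emb ?t] =>
      lazymatch t with
      | ?x + ?y => rewrite (embD x y)
      | ?x * ?y => rewrite (embM x y)
      | 1 => rewrite emb1
      | 0 => rewrite emb0
      end
  end;
  repeat match goal with
  | H : context [emb ?x] |- _ =>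
      lazymatch goal with
      | _ : is_true (0 <= emb x) |- _ => fail
      | _ => pose proof (emb_ge0 x)
      end
  | |- context [emb ?x] =>
      lazymatch goal with
      | _ : is_true (0 <= emb x) |- _ => fail
      | _ => pose proof (emb_ge0 x)
      end
  end.
Ltac mlra := emb_facts; lra.
Ltac mnra := emb_facts; nra.

Section Recursive.

Variable M : rca_model.
Let N := num M.
Let env := nat -> N.
Implicit Types P Q : env -> Prop.

Lemma ltmS (x y : N) : x <! y + 1 <-> x <! y \/ x = y.
Proof. exact: mltxS. Qed.

Lemma ltm0 (x : N) : ~ x <! 0.
Proof. exact: mltx0. Qed.

Lemma D0_bex2 (Q : env -> Prop) : D0 Q -> D0 (fun e => exists x, x <! e 0%N /\
  exists y, y <! e 0%N /\ Q (scons y (scons x (fun k => e k.+1)))).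
Proof.
move=> DQ; apply: (D0_bex (P := fun x e => exists y, y <! e 0%N /\
  Q (scons y (scons x (fun k => e k.+1))))); first by solve_term_def.
apply: (D0_bex (F := fun e => e 1%N)
  (P := fun y e => Q (scons y (scons (e 0%N) (fun k => e k.+2))))).
  by solve_term_def.
pose f k := if k is k'.+2 then k'.+3 else k.
apply: D0_iff (D0_rename f DQ) => e.
by have -> : (fun k => e (f k)) = scons (e 0%N) (scons (e 1%N) (fun k => e k.+3))
  by apply: funext => -[|[|k]].
Qed.

(** [S1] allows one unbounded quantifier. Two of them are traded for a common bound, below which
    both witnesses are sought by bounded quantifiers. *)
Lemma S1_exists (P : N -> env -> Prop) :
  S1 (fun e => P (e 0%N) (fun k => e k.+1)) -> S1 (fun e => exists x, P x e).
Proof.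
move=> [Q DQ HQ]; eexists; first exact: D0_bex2 DQ.
move=> e; split=> [[x Px]|[z [x [_ [y [_ Qxy]]]]]].
  have [y Qxy] := (HQ (scons x e)).1 Px.
  exists (x + y + 1), x => /=.
    by split; [mlra|exists y; split; [mlra|]].
by exists x; apply/(HQ (scons x e)); exists y.
Qed.

Lemma S1_and P Q : S1 P -> S1 Q -> S1 (fun e => P e /\ Q e).
Proof.
move=> [P' DP HP] [Q' DQ HQ].
have H : S1 (fun e => exists x, exists y, P' (scons x e) /\ Q' (scons y e)).
  apply: (S1_exists (P := fun x e => exists y, P' (scons x e) /\ Q' (scons y e))).
  apply: (S1_exists (P := fun y e => P' (scons (e 0%N) (fun k => e k.+1)) /\
    Q' (scons y (fun k => e k.+1)))).
  apply/S1_D0/D0_and.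
    apply: D0_iff (D0_rename (fun k => k.+1) DP) => e /=.
    by rewrite (sconsE (fun k => e k.+1)).
  pose f k := if k is k'.+1 then k'.+2 else 0%N.
  apply: D0_iff (D0_rename f DQ) => e /=.
  by have -> : (fun k => e (f k)) = scons (e 0%N) (fun k => e k.+2)
    by apply: funext => -[].
apply: S1_iff H => e; rewrite HP HQ; split=> [[x [y [? ?]]]|[[x ?] [y ?]]].
  by split; [exists x|exists y].
by exists x, y.
Qed.

Lemma S1_or P Q : S1 P -> S1 Q -> S1 (fun e => P e \/ Q e).
Proof.
move=> [P' DP HP] [Q' DQ HQ]; exists (fun e => P' e \/ Q' e); first exact: D0_or.
move=> e; rewrite HP HQ; split=> [[[x ?]|[x ?]]|[x [?|?]]].
- by exists x; left.
- by exists x; right.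
- by left; exists x.
- by right; exists x.
Qed.

(** As [F] is total, a Sigma_1 graph is already Delta_1: a wrong value is refuted by exhibiting the
    right one. *)
Definition rec (F : env -> N) := S1 (fun e => e 0%N = F (fun k => e k.+1)).

Lemma S1_comp (P : N -> env -> Prop) F :
  S1 (fun e => P (e 0%N) (fun k => e k.+1)) -> rec F -> S1 (fun e => P (F e) e).
Proof.
move=> HP HF; apply: S1_iff (S1_exists (P := fun x e => x = F e /\ P x e)
  (S1_and HF HP)) => e.
by split=> [[x [-> //]]|?]; exists (F e).
Qed.

(* The bounded quantifier is absorbed by Sigma_1 collection: Sigma_1 induction on
   the bound [b] yields one [z] bounding the witnesses for all [x < b]. *)
Lemma S1_ball F (P : N -> env -> Prop) : rec F ->
  S1 (fun e => P (e 0%N) (fun k => e k.+1)) ->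
  S1 (fun e => forall x, x <! F e -> P x e).
Proof.
move=> HF [Q DQ HQ]; apply: (S1_comp (P := fun b e => forall x, x <! b -> P x e)) HF.
pose R b z e := forall x, x <! b -> exists y, y <! z /\ Q (scons y (scons x e)).
have DR : D0 (fun e => R (e 1%N) (e 0%N) (fun k => e k.+2)).
  apply: (D0_ball (F := fun e => e 1%N) (P := fun x e => exists y, y <! e 0%N /\
    Q (scons y (scons x (fun k => e k.+2))))); first by solve_term_def.
  apply: (D0_bex (F := fun e => e 1%N) (P := fun y e =>
    Q (scons y (scons (e 0%N) (fun k => e k.+3))))); first by solve_term_def.
  pose f k := if k is k'.+2 then k'.+4 else k.
  apply: D0_iff (D0_rename f DQ) => e.
  by have -> : (fun k => e (f k)) = scons (e 0%N) (scons (e 1%N) (fun k => e k.+4))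
    by apply: funext => -[|[|k]].
exists (fun e => R (e 1%N) (e 0%N) (fun k => e k.+2)) => // e /=.
set b := e 0%N; set t := fun k => e k.+1; split; last first.
  by move=> [z Hz] x /Hz[y [_ Hy]]; apply/(HQ (scons x t)); exists y.
(* The induction runs over all [c], but witnesses are available only below [b]; hence the guard
   [x <! b]. *)
move=> HP; pose B c z := forall x, x <! c -> x <! b -> exists y, y <! z /\ Q (scons y (scons x t)).
suff H c : exists z, B c z.
  by have [z Hz] := H b; exists z => x xb; exact: Hz.
have SB : S1 (fun e => exists z, B (e 0%N) z).
  apply: (S1_exists (P := fun z e => B (e 0%N) z)); apply: S1_D0.
  apply: (D0_ball (F := fun e => e 1%N) (P := fun x e => x <! b -> exists y,
    y <! e 0%N /\ Q (scons y (scons x t)))); first by solve_term_def.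
  apply: D0_imp; first by solve_D0.
  apply: (D0_bex (F := fun e => e 1%N) (P := fun y e =>
    Q (scons y (scons (e 0%N) t)))); first by solve_term_def.
  pose g k := if k is k'.+2 then None else Some k.
  apply: D0_iff (D0_subst g (fun k => t (k.-2)) DQ) => e'.
  by have -> : (fun k => if g k is Some j then e' j else t k.-2) =
    scons (e' 0%N) (scons (e' 1%N) t) by apply: funext => -[|[|k]].
elim/induction_model: c => //; first by exists 0 => x /ltm0.
move=> c [z Bz]; have [cb|ncb] := lem (c <! b); last first.
  by exists z => x /ltmS[|->] // xc xb; exact: Bz.
have [y Qy] := (HQ (scons c t)).1 (HP c cb).
exists (z + y + 1) => x /ltmS[xc xb|-> _].
  by have [y' [y'z Qy']] := Bz x xc xb; exists y'; split=> //; mlra.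
by exists y; split=> //; mlra.
Qed.

End Recursive.

(** * Delta_1 predicates and recursive functions *)

Section Delta1.

Variable M : rca_model.
Let N := num M.
Let env := nat -> N.
Implicit Types (P Q : env -> Prop) (F G H : env -> N).

Definition D1 P := S1 P /\ S1 (fun e => ~ P e).

Lemma D1_S1 P : D1 P -> S1 P. Proof. by case. Qed.

Lemma D1_iff P Q : (forall e, P e <-> Q e) -> D1 P -> D1 Q.
Proof. by move=> PQ [HP HnP]; split; [apply: S1_iff HP|apply: S1_iff HnP => e; rewrite PQ]. Qed.

Lemma D1_D0 P : D0 P -> D1 P.
Proof. by move=> HP; split; apply: S1_D0 => //; exact: D0_not. Qed.

Lemma D1_not P : D1 P -> D1 (fun e => ~ P e).
Proof. by case=> HP HnP; split=> //; apply: S1_iff HP => e; split=> [? []//|/contrapT]. Qed.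

Lemma D1_and P Q : D1 P -> D1 Q -> D1 (fun e => P e /\ Q e).
Proof.
move=> [HP HnP] [HQ HnQ]; split; first exact: S1_and.
by apply: S1_iff (S1_or HnP HnQ) => e; have [] := lem (P e); tauto.
Qed.

Lemma D1_or P Q : D1 P -> D1 Q -> D1 (fun e => P e \/ Q e).
Proof.
move=> [HP HnP] [HQ HnQ]; split; first exact: S1_or.
by apply: S1_iff (S1_and HnP HnQ) => e; tauto.
Qed.

Lemma D1_imp P Q : D1 P -> D1 Q -> D1 (fun e => P e -> Q e).
Proof.
move=> HP HQ; apply: D1_iff (D1_or (D1_not HP) HQ) => e.
by have [] := lem (P e); tauto.
Qed.

(** The complement is a bounded universal quantifier over a Sigma_1 predicate, so this closure
    property rests on collection. *)
Lemma D1_bex F (P : N -> env -> Prop) : rec F ->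
  D1 (fun e => P (e 0%N) (fun k => e k.+1)) ->
  D1 (fun e => exists x, x <! F e /\ P x e).
Proof.
move=> HF [HP HnP]; split.
  apply: (S1_comp (P := fun b e => exists x, x <! b /\ P x e)) HF.
  apply: (S1_exists (P := fun x e => x <! e 0%N /\ P x (fun k => e k.+1))).
  apply: S1_and; first by apply: S1_D0; apply: D0_lt; solve_term_def.
  exact: (S1_rename (fun k => if k is k'.+1 then k'.+2 else 0%N) HP).
apply: S1_iff (S1_ball (P := fun x e => ~ P x e) HF HnP) => e.
by split=> [H [x [xF Px]]|H x xF Px]; [exact: H Px|apply: H; exists x].
Qed.

Lemma D1_ball F (P : N -> env -> Prop) : rec F ->
  D1 (fun e => P (e 0%N) (fun k => e k.+1)) ->
  D1 (fun e => forall x, x <! F e -> P x e).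
Proof.
move=> HF HP; apply: D1_iff (D1_not (D1_bex (P := fun x e => ~ P x e) HF (D1_not HP))) => e.
split=> [H x xF|H [x [xF nPx]]]; last exact/nPx/H.
by apply: contrapT => nPx; apply: H; exists x.
Qed.

Lemma rec_rename f F : rec F -> rec (fun e => F (fun k => e (f k))).
Proof. exact: (S1_rename (fun k => if k is k'.+1 then (f k').+1 else 0%N)). Qed.

Lemma rec_term F : term_def F -> rec F.
Proof.
move=> [t [r Ht]]; apply: S1_D0; apply: D0_eq; first exact: term_def_var.
have /choice[g Hg] k : exists j, forall e : env, mix e r j = mix (fun k => e k.+1) r k.
  have [[j ->]|[j ->]] := even_or_odd k; [exists j.+1.*2|exists j.*2.+1];
    by move=> e; rewrite ?mix_odd ?mix_even.
exists (tsubst (fun k => tvar (g k)) t), r => e.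
by rewrite tval_subst -Ht; congr tval; apply: funext => k; exact: Hg.
Qed.

Lemma rec_var k : rec (fun e : env => e k). Proof. exact/rec_term/term_def_var. Qed.
Lemma rec_const (c : N) : rec (fun _ : env => c). Proof. exact/rec_term/term_def_const. Qed.

Lemma S1_app4 (R : N -> N -> N -> N -> Prop) F G H K :
  S1 (fun e => R (e 0%N) (e 1%N) (e 2%N) (e 3%N)) ->
  rec F -> rec G -> rec H -> rec K -> S1 (fun e => R (F e) (G e) (H e) (K e)).
Proof.
move=> HR HF HG HH HK.
have HG' := rec_rename (fun k => k.+1) HG.
have HH' := rec_rename (fun k => k.+2) HH.
have HK' := rec_rename (fun k => k.+3) HK.
apply: (S1_comp (P := fun x e => R x (G e) (H e) (K e))) HF.
apply: (S1_comp (P := fun y e => R (e 0%N) y (H (fun k => e k.+1)) (K (fun k => e k.+1)))) HG'.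
apply: (S1_comp (P := fun z e => R (e 1%N) (e 0%N) z (K (fun k => e k.+2)))) HH'.
apply: (S1_comp (P := fun z e => R (e 2%N) (e 1%N) (e 0%N) z)) HK'.
(* Each substitution puts its variable at index 0, so the four arguments end up in reverse order. *)
exact: (S1_rename (fun k => nth k [:: 3; 2; 1; 0]%N k) HR).
Qed.

Lemma D1_app4 (R : N -> N -> N -> N -> Prop) F G H K :
  D1 (fun e => R (e 0%N) (e 1%N) (e 2%N) (e 3%N)) ->
  rec F -> rec G -> rec H -> rec K -> D1 (fun e => R (F e) (G e) (H e) (K e)).
Proof.
move=> [HR HnR] *; split; first exact: S1_app4.
exact: (S1_app4 (R := fun a b c d => ~ R a b c d)).
Qed.

Definition dec1 (R : N -> Prop) := D1 (fun e => R (e 0%N)).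
Definition dec2 (R : N -> N -> Prop) := D1 (fun e => R (e 0%N) (e 1%N)).
Definition dec3 (R : N -> N -> N -> Prop) := D1 (fun e => R (e 0%N) (e 1%N) (e 2%N)).
Definition dec4 (R : N -> N -> N -> N -> Prop) :=
  D1 (fun e => R (e 0%N) (e 1%N) (e 2%N) (e 3%N)).
Definition rec1 (f : N -> N) := rec (fun e => f (e 0%N)).
Definition rec2 (f : N -> N -> N) := rec (fun e => f (e 0%N) (e 1%N)).
Definition rec3 (f : N -> N -> N -> N) := rec (fun e => f (e 0%N) (e 1%N) (e 2%N)).

Lemma D1_app3 R F G H : dec3 R -> rec F -> rec G -> rec H -> D1 (fun e => R (F e) (G e) (H e)).
Proof. by move=> HR *; apply: (D1_app4 (R := fun a b c d => R a b c)) (rec_const 0). Qed.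
Lemma D1_app2 R F G : dec2 R -> rec F -> rec G -> D1 (fun e => R (F e) (G e)).
Proof. by move=> HR *; apply: (D1_app3 (R := fun a b c => R a b)) (rec_const 0). Qed.
Lemma D1_app1 R F : dec1 R -> rec F -> D1 (fun e => R (F e)).
Proof. by move=> HR *; apply: (D1_app2 (R := fun a b => R a)) (rec_const 0). Qed.

Lemma rec_app3 f F G H : rec3 f -> rec F -> rec G -> rec H -> rec (fun e => f (F e) (G e) (H e)).
Proof.
move=> Hf HF HG HH; exact: (S1_app4 (R := fun a b c d => a = f b c d)) Hf (rec_var 0)
  (rec_rename (fun k => k.+1) HF) (rec_rename (fun k => k.+1) HG)
  (rec_rename (fun k => k.+1) HH).
Qed.
Lemma rec_app2 f F G : rec2 f -> rec F -> rec G -> rec (fun e => f (F e) (G e)).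
Proof. by move=> Hf *; apply: (rec_app3 (f := fun a b _ => f a b)) (rec_const 0). Qed.
Lemma rec_app1 f F : rec1 f -> rec F -> rec (fun e => f (F e)).
Proof. by move=> Hf *; apply: (rec_app2 (f := fun a _ => f a)) (rec_const 0). Qed.

Lemma rec_add F G : rec F -> rec G -> rec (fun e => F e + G e).
Proof. by apply: rec_app2; apply: rec_term; solve_term_def. Qed.
Lemma rec_mul F G : rec F -> rec G -> rec (fun e => F e * G e).
Proof. by apply: rec_app2; apply: rec_term; solve_term_def. Qed.

Lemma D1_eq F G : rec F -> rec G -> D1 (fun e => F e = G e).
Proof. by apply: (D1_app2 (R := eq)); apply: D1_D0; solve_D0. Qed.
Lemma D1_lt F G : rec F -> rec G -> D1 (fun e => F e <! G e).
Proof. by apply: (D1_app2 (R := @mlt M)); apply: D1_D0; solve_D0. Qed.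
Lemma D1_mem F X : rec F -> D1 (fun e => mmem (F e) X).
Proof. by apply: (D1_app1 (R := fun x => mmem x X)); apply: D1_D0; solve_D0. Qed.

End Delta1.

Create HintDb recdb.
Ltac rec_base := solve [assumption | auto with recdb nocore].

Ltac solve_rec :=
  cbn beta;
  lazymatch goal with
  | |- rec (fun e => e ?k) => exact: rec_var
  | |- rec (fun _ => ?c) => exact: rec_const
  | |- rec (fun e => @?F e + @?G e) => apply: (rec_add (F := F) (G := G)); solve_rec
  | |- rec (fun e => @?F e * @?G e) => apply: (rec_mul (F := F) (G := G)); solve_rec
  | _ => first
    [ lazymatch goal with |- rec (fun e => ?f (@?F e) (@?G e) (@?H e)) =>
        apply: (rec_app3 (f := f) (F := F) (G := G) (H := H)); [rec_base| | |] end
    | lazymatch goal with |- rec (fun e => ?f (@?F e) (@?G e)) =>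
        apply: (rec_app2 (f := f) (F := F) (G := G)); [rec_base| |] end
    | lazymatch goal with |- rec (fun e => ?f (@?F e)) =>
        apply: (rec_app1 (f := f) (F := F)); [rec_base|] end ]; solve_rec
  end.

Ltac solve_D1 :=
  cbn beta;
  lazymatch goal with
  | |- D1 (fun e => ~ @?P e) => apply: (D1_not (P := P)); solve_D1
  | |- D1 (fun e => forall x, x <! @?F e -> @?P x e) =>
      apply: (D1_ball (F := F) (P := P)); [solve_rec|solve_D1]
  | |- D1 (fun e => exists x, x <! @?F e /\ @?P x e) =>
      apply: (D1_bex (F := F) (P := P)); [solve_rec|solve_D1]
  | |- D1 (fun e => @?P e /\ @?Q e) => apply: (D1_and (P := P) (Q := Q)); solve_D1
  | |- D1 (fun e => @?P e \/ @?Q e) => apply: (D1_or (P := P) (Q := Q)); solve_D1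
  | |- D1 (fun e => @?P e -> @?Q e) => apply: (D1_imp (P := P) (Q := Q)); solve_D1
  | |- D1 (fun e => @?F e = @?G e) => apply: (D1_eq (F := F) (G := G)); solve_rec
  | |- D1 (fun e => @?F e <! @?G e) => apply: (D1_lt (F := F) (G := G)); solve_rec
  | |- D1 (fun e => mmem (@?F e) ?X) => apply: (D1_mem (F := F) X); solve_rec
  | _ => first
    [ lazymatch goal with |- D1 (fun e => ?R (@?F e) (@?G e) (@?H e) (@?K e)) =>
        apply: (D1_app4 (R := R) (F := F) (G := G) (H := H) (K := K)); [rec_base| | | |] end
    | lazymatch goal with |- D1 (fun e => ?R (@?F e) (@?G e) (@?H e)) =>
        apply: (D1_app3 (R := R) (F := F) (G := G) (H := H)); [rec_base| | |] end
    | lazymatch goal with |- D1 (fun e => ?R (@?F e) (@?G e)) =>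
        apply: (D1_app2 (R := R) (F := F) (G := G)); [rec_base| |] end
    | lazymatch goal with |- D1 (fun e => ?R (@?F e)) =>
        apply: (D1_app1 (R := R) (F := F)); [rec_base|] end ]; solve_rec
  end.

Ltac solve_S1 :=
  cbn beta;
  lazymatch goal with
  | |- S1 (fun e => exists x, @?P x e) => apply: (S1_exists (P := P)); solve_S1
  | |- S1 (fun e => forall x, x <! @?F e -> @?P x e) =>
      apply: (S1_ball (F := F) (P := P)); [solve_rec|solve_S1]
  | |- S1 (fun e => @?P e /\ @?Q e) => apply: (S1_and (P := P) (Q := Q)); solve_S1
  | |- S1 (fun e => @?P e \/ @?Q e) => apply: (S1_or (P := P) (Q := Q)); solve_S1
  | _ => apply: D1_S1; solve_D1
  end.

(** * Least number principle and pairing *)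

Section FiniteCodes.

Variable M : rca_model.
Let N := num M.
Implicit Types x y z c m k : N.

Lemma comprehension_D1 (P : N -> Prop) :
  dec1 P -> exists X, forall x, mmem x X <-> P x.
Proof. by case; exact: comprehension_model. Qed.

Lemma S1_ind (P : N -> Prop) : S1 (fun e => P (e 0%N)) ->
  P 0 -> (forall x, P x -> P (x + 1)) -> forall x, P x.
Proof. exact: induction_model. Qed.

(** Sigma_1 induction on the absence of elements below [y], which stays Delta_1 because its
    quantifier is bounded. *)
Lemma least (P : N -> Prop) : dec1 P -> (exists x, P x) ->
  exists x, P x /\ forall y, y <! x -> ~ P y.
Proof.
move=> DP [x Px]; apply: contrapT => nleast.
suff H y : forall z, z <! y -> ~ P z by apply: (H (x + 1) x) => //; mlra.
elim/S1_ind: y; first by solve_S1.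
  by move=> z /ltm0.
move=> y IH z /ltmS[/IH//|-> Py]; apply: nleast; by exists y.
Qed.

Lemma zero_or_succ x : x = 0 \/ exists y, x = y + 1.
Proof.
suff [->|[y [_ ->]]] : x = 0 \/ exists y, y <! x /\ x = y + 1; [by left|by right; exists y|].
elim/S1_ind: x; [by solve_S1|by left|move=> x _; right].
by exists x; split=> //; mlra.
Qed.

Definition pair (x y : N) : N := (x + y) * (x + y) + x.

Lemma rec_pair : rec2 pair.
Proof. by rewrite /rec2 /pair; solve_rec. Qed.

Lemma emb_sq x : emb x <= emb x * emb x.
Proof.
have [->|[y ->]] := zero_or_succ x; first by rewrite emb0; lra.
by rewrite embD emb1; have := emb_ge0 y; nra.
Qed.

(** Since [x] is at most [x + y], the code lies between the squares of [x + y] and [x + y + 1], the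
    latter excluded; so it determines the sum, and then [x]. *)
Lemma pair_inj x y x' y' : pair x y = pair x' y' -> x = x' /\ y = y'.
Proof.
have key a b c d : a + b <! c + d -> pair a b <> pair c d.
  by rewrite /pair => H E; mnra.
have [/key //|[E|/key H /esym //]] := mlt_total (x + y) (x' + y').
rewrite /pair E => /(congr1 (@emb M)); rewrite !embD => Ex.
have {}Ex : x = x' by apply: emb_inj; lra.
by split=> //; apply: (@addmI _ _ _ x); rewrite addrC [LHS]E Ex addrC.
Qed.

Lemma le_pair_l x y : x <! pair x y + 1.
Proof. by rewrite /pair; mnra. Qed.

Lemma le_pair_r x y : y <! pair x y + 1.
Proof.
rewrite /pair; have := emb_sq (x + y); rewrite embD => H; mlra.
Qed.

End FiniteCodes.
#[export] Hint Resolve rec_pair : recdb.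

(** * Primitive recursion *)

Section Recursion.

Variable M : rca_model.
Let N := num M.
Implicit Types x y z c m k : N.

Definition divides (d n : N) := exists z, n = z * d.

Lemma divides_mull d n x : divides d n -> divides d (x * n).
Proof. by move=> [z ->]; exists (x * z); rewrite mulrA. Qed.

Lemma divides_sub d n n' : divides d (n + n') -> divides d n -> divides d n'.
Proof.
move=> [z E] [w Ew]; rewrite Ew in E.
have [/ltm_ex[u Eu]|[Eu|/ltm_ex[u Eu]]] := mlt_total w z.
- exists (u + 1); apply: (@addmI _ _ _ (w * d)); rewrite addrC E -Eu.
  by ring.
- by exists 0; apply: (@addmI _ _ _ (w * d)); rewrite addrC E Eu; ring.
- exists 0; apply: (@addmI _ _ _ (w * d)); rewrite addrC E; apply: emb_inj.
  have : emb (w * d + n') = emb (z * d) by rewrite E.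
  rewrite -Eu !(embD, embM, emb1, emb0).
  have := emb_ge0 n'; have := emb_ge0 u; have := emb_ge0 d; have := emb_ge0 z.
  by nra.
Qed.

(** The moduli of Goedel's beta function. Sets are coded by divisibility instead of remainders,
    which avoids the Chinese remainder theorem. *)
Definition modulus (m x : N) := (x + 1) * m + 1.

(* [(x + 1) p_y] and [(y + 1) p_x] differ by [|x - y|], a divisor of [m], and [p_x] is
   prime to [m]. *)
Lemma modulus_coprime m k c x y :
  (forall d, d <! k -> divides (d + 1) m) -> x <! k -> y <! k -> x <> y ->
  divides (modulus m x) (c * modulus m y) -> divides (modulus m x) c.
Proof.
move=> Hm xk yk xy; set p := modulus m x => Hc.
have [d [dk E]] : exists d, d <! k /\
    ((x + 1) * modulus m y = (y + 1) * p + (d + 1) \/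
     (x + 1) * modulus m y + (d + 1) = (y + 1) * p).
  have [/ltm_ex[d Ed]|[//|/ltm_ex[d Ed]]] := mlt_total x y; exists d; split.
  - by mlra.
  - by right; rewrite /p /modulus -Ed; ring.
  - by mlra.
  - by left; rewrite /p /modulus -Ed; ring.
have Hd : divides p (c * (d + 1)).
  case: E => E.
    apply: (@divides_sub p (c * (y + 1) * p)); last by exists (c * (y + 1)).
    rewrite -mulrA -mulrDr -E mulrCA; exact: divides_mull.
  apply: (@divides_sub p (c * (x + 1) * modulus m y)).
    by rewrite -mulrA -mulrDr E mulrA; exists (c * (y + 1)).
  by rewrite -mulrA mulrCA; exact: divides_mull.
have [w Ew] := Hm d dk.
apply: (@divides_sub p (c * m * (x + 1))); first by exists c; rewrite /p /modulus; ring.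
have -> : c * m * (x + 1) = (x + 1) * w * (c * (d + 1)) by rewrite Ew; ring.
exact: divides_mull.
Qed.

(** Stands in for the factorial of [k], which cannot be defined before primitive recursion. *)
Lemma common_multiple k : exists m, 0 <! m /\ forall d, d <! k -> divides (d + 1) m.
Proof.
suff [m [m0 Hm]] : exists m, 0 <! m /\
    forall d, d <! k -> exists z, z <! m + 1 /\ m = z * (d + 1).
  by exists m; split=> // d /Hm[z [_ Ez]]; exists z.
elim/S1_ind: k; first by solve_S1.
  by exists 1; split=> [|d /ltm0//]; mlra.
move=> k [m [m0 Hm]]; exists (m * (k + 1)); split; first by mnra.
move=> d /ltmS[/Hm[z [zm Ez]]|->]; last first.
  by exists m; split=> //; mnra.
exists (z * (k + 1)); split; last by rewrite {1}Ez; ring.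
by mnra.
Qed.

(* [c], [m], [k] code the set of all [x < k] such that [1 + (x + 1) m] divides [c]. *)
Definition elt x c m k := x <! k /\ exists z, z <! c + 1 /\ c = z * modulus m x.

Lemma dec_elt : dec4 elt.
Proof. by rewrite /dec4 /elt /modulus; solve_D1. Qed.

Lemma eltE x c m k : elt x c m k <-> x <! k /\ divides (modulus m x) c.
Proof.
split=> -[xk]; first by move=> [z [_ Ez]]; split=> //; exists z.
move=> [z Ez]; split=> //; exists z; split=> //.
by rewrite Ez /modulus; have H := emb_ge0 (z * ((x + 1) * m)); mlra.
Qed.

(** The code is the product of the moduli of the members, built up by Sigma_1 induction on [j];
    coprimality ensures that no other modulus divides it. *)
Lemma finite_set (P : N -> Prop) k : dec1 P ->
  exists c m, forall x, elt x c m k <-> x <! k /\ P x.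
Proof.
move=> DP; have [m [m0 Hm]] := common_multiple k.
have [c Hc] : exists c, forall x, x <! k ->
    (elt x c m k -> x <! k /\ P x) /\ (x <! k /\ P x -> elt x c m k).
  suff H j : exists c, forall x, x <! k ->
      (elt x c m k -> x <! j /\ P x) /\ (x <! j /\ P x -> elt x c m k) by exact: H.
  have Delt := dec_elt; elim/S1_ind: j; first by solve_S1.
    (* As [m] is positive, every modulus exceeds 1, so 1 codes the empty set. *)
    exists 1 => x xk; split=> [/eltE[_ [z Ez]]|[/ltm0//]].
    exfalso; move: Ez; rewrite /modulus.
    have [->|[w ->]] := zero_or_succ z => Ez; first by mlra.
    by have H := emb_ge0 (w * (x + 1) * m); have H' := emb_ge0 (x * m); mlra.
  move=> j [c Hc]; have [[jk Pj]|nj] := lem (j <! k /\ P j); last first.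
    exists c => x xk; have [H1 H2] := Hc x xk; split=> [/H1[]|[/ltmS[xj|xj] Px]].
    - by split=> //; apply/ltmS; left.
    - exact: H2.
    - by case: nj; rewrite -xj.
  exists (c * modulus m j) => x xk; have [H1 H2] := Hc x xk.
  rewrite eltE; split=> [[_ Hx]|[/ltmS[xj|->] Px]]; first last.
  - by split=> //; exists c.
  - split=> //; rewrite mulrC; apply: divides_mull.
    by have /eltE[] := H2 (conj xj Px).
  have [->|xj] := lem (x = j); first by split=> //; apply/ltmS; right.
  have /H1[? ?] : elt x c m k by apply/eltE; split=> //; exact: modulus_coprime Hm xk jk xj Hx.
  by split=> //; apply/ltmS; left.
exists c, m => x; split=> [Hx|[xk Px]]; last exact: (Hc x xk).2.
by apply: (Hc x _).1 => //; case: Hx.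
Qed.

Variables (a : N -> N) (g : N -> N -> N -> N).
Hypotheses (rec_a : rec1 a) (rec_g : rec3 g).

(** A computation is a finite set of pairs [(i, v)], each one justified by the initial value or by a
    pair for the predecessor of [i]. All quantifiers are bounded, by size estimates for pairs and
    members, which makes the notion Delta_1. *)
Definition trace c m k p := forall w, w <! k -> elt w c m k ->
  forall i, i <! w + 1 -> forall v, v <! w + 1 -> w = pair i v ->
  (i = 0 /\ v = a p) \/
  exists j, j <! i /\ exists v', v' <! k /\
    (i = j + 1 /\ elt (pair j v') c m k /\ v = g p j v').

Lemma dec_trace : dec4 trace.
Proof. by rewrite /dec4 /trace; have De := dec_elt; solve_D1. Qed.

Lemma traceP c m k p i v : trace c m k p -> elt (pair i v) c m k ->
  (i = 0 /\ v = a p) \/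
  exists j v', [/\ i = j + 1, elt (pair j v') c m k & v = g p j v'].
Proof.
move=> T Hiv; have [ivk _] := Hiv.
case: (T _ ivk Hiv _ (le_pair_l i v) _ (le_pair_r i v) erefl) => [|[j [_ [v' [_ [? [? ?]]]]]]].
  by left.
by right; exists j, v'.
Qed.

Definition reaches p n y := exists c m k, trace c m k p /\ elt (pair n y) c m k.

Lemma S1_reaches : S1 (fun e => reaches (e 0%N) (e 1%N) (e 2%N)).
Proof. by rewrite /reaches; have De := dec_elt; have Dt := dec_trace; solve_S1. Qed.

Lemma reaches_fun p n y y' : reaches p n y -> reaches p n y' -> y = y'.
Proof.
move=> [c [m [k [T Hy]]]] [c' [m' [k' [T' Hy']]]].
(* Members of the traces are below [k] and [k'], so quantifying [v] and [v'] below these bounds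
   loses nothing and keeps the induction predicate Sigma_1. *)
suff H i : forall v, v <! k -> forall v', v' <! k' ->
    elt (pair i v) c m k -> elt (pair i v') c' m' k' -> v = v'.
  have [yk _] := Hy; have [yk' _] := Hy'.
  have yl := le_pair_r n y; have yl' := le_pair_r n y'.
  by apply: (H n y _ y') => //; mlra.
have De := dec_elt; elim/S1_ind: i {Hy Hy'}; first by solve_S1.
  move=> v _ v' _ /(traceP T)[[_ ->]|[j [w [E _ _]]]]; last first.
    by case: (addm1_neq0 (esym E)).
  move=> /(traceP T')[[_ ->] //|[j [w [E _ _]]]].
  by case: (addm1_neq0 (esym E)).
move=> i IH v _ v' _ /(traceP T)[[E _]|[j [w [/addmI <- Hw ->]]]].
  by case: (addm1_neq0 E).
move=> /(traceP T')[[E _]|[j' [w' [/addmI <- Hw' ->]]]].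
  by case: (addm1_neq0 E).
have [wk _] := Hw; have [wk' _] := Hw'.
have wl := le_pair_r i w; have wl' := le_pair_r i w'.
by congr g; apply: (IH w _ w') => //; mlra.
Qed.

Lemma reaches0 p y : reaches p 0 y -> y = a p.
Proof.
move=> [c [m [k [T /(traceP T)]]]] [[_ //]|[j [w [E _ _]]]].
by case: (addm1_neq0 (esym E)).
Qed.

Lemma reachesS p n y : reaches p (n + 1) y -> exists2 y', reaches p n y' & y = g p n y'.
Proof.
move=> [c [m [k [T /(traceP T)]]]] [[E _]|[j [w [/addmI <- Hw ->]]]].
  by case: (addm1_neq0 E).
by exists w => //; exists c, m, k.
Qed.

(** The step adjoins one pair to the old trace and recodes the result with [finite_set]; the new
    bound leaves room for the new pair. *)
Lemma reaches_ex p n : exists y, reaches p n y.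
Proof.
have De := dec_elt; elim/S1_ind: n.
- by have Sr := S1_reaches; apply: (S1_exists (P := fun y e => reaches p (e 0%N) y));
    apply: (S1_app4 (R := fun p n y _ => reaches p n y)) Sr _ _ _ (rec_const 0); solve_rec.
- have [|c [m H]] := @finite_set (fun w => w = pair 0 (a p)) (pair 0 (a p) + 1).
    by rewrite /dec1; solve_D1.
  exists (a p), c, m, (pair 0 (a p) + 1); split.
    by move=> w _ /H[_ ->] i _ v _ /pair_inj[<- <-]; left.
  by apply/H; split=> //; mlra.
- move=> n [y [c [m [k [T Hy]]]]].
  set w := pair (n + 1) (g p n y).
  have [|c' [m' H]] := @finite_set (fun x => elt x c m k \/ x = w) (k + w + 1).
    by rewrite /dec1; solve_D1.
  have up x : elt x c m k -> elt x c' m' (k + w + 1).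
    by move=> Hx; apply/H; split; [case: Hx => Hx _; mlra|left].
  exists (g p n y), c', m', (k + w + 1); split; last first.
    by apply/H; split; [mlra|right].
  move=> x _ /H[_ [Hx|->]] i il v vl E.
    rewrite E in Hx; case: (traceP T Hx) => [|[j [v' [Ej Hv' Ev]]]]; first by left.
    right; exists j; split; first by mlra.
    have [v'k _] := Hv'; have v'l := le_pair_r j v'.
    by exists v'; split; [mlra|split=> //; split=> //; exact: up].
  have [<- <-] := pair_inj E; right; exists n; split; first by mlra.
  have [yk _] := Hy; have yl := le_pair_r n y.
  by exists y; split; [mlra|split=> //; split=> //; exact: up].
Qed.

Theorem primitive_recursion : exists f : N -> N -> N,
  [/\ rec2 f, forall p, f p 0 = a p & forall p n, f p (n + 1) = g p n (f p n)].
Proof.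
have /choice[F HF] (pn : N * N) : exists y, reaches pn.1 pn.2 y.
  exact: reaches_ex.
exists (fun p n => F (p, n)); split.
- apply: (S1_iff (P := fun e => reaches (e 1%N) (e 2%N) (e 0%N))).
    move=> e; split=> [H|->]; last exact: HF (_, _).
    exact: reaches_fun H (HF (_, _)).
  exact: (S1_rename (fun i => nth i [:: 1; 2; 0]%N i) S1_reaches).
- by move=> p; exact: reaches0 (HF (p, 0)).
- move=> p n; have [y Hy E] := reachesS (HF (p, n + 1)).
  by rewrite E; congr g; exact: reaches_fun Hy (HF (p, n)).
Qed.

End Recursion.

(** * The principles in a model *)

Section Semantics.

Variable M : rca_model.
Local Notation N := (num M).
Implicit Types (q r : ratio M) (P : ratio M -> Prop) (X F C : sets M).

(** This and the following predicates copy the object-level formulas connective by connective,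
    including artefacts such as [n = n], so that satisfaction can be matched with them
    structurally. *)
Definition mle (x y : N) := x <! y \/ x = y.

Definition in_graph X (k j : N) := mmem (pair k j) X.
Definition qcd q : N := pair (pair q.1.1 q.1.2) q.2.

Definition s_is_fun F := forall i, exists j, forall k, in_graph F i k <-> k = j.
Definition s_qle q r := mle (q.1.1 * (r.2 + 1) + r.1.2 * (q.2 + 1))
                             (r.1.1 * (q.2 + 1) + q.1.2 * (r.2 + 1)).
Definition s_qlt q r := q.1.1 * (r.2 + 1) + r.1.2 * (q.2 + 1) <!
                        r.1.1 * (q.2 + 1) + q.1.2 * (r.2 + 1).
Definition s_qabs q P := (s_qle (0, 0, 0) q -> P q) /\ (s_qlt q (0, 0, 0) -> P (ropp q)).
Definition s_allqpos P := forall a b c, s_qlt (0, 0, 0) (a, b, c) -> P (a, b, c).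

Definition s_val_at X k :=
  exists a b c, forall j, in_graph X k j <-> j = qcd (a, b, c).
Definition s_entry X k P :=
  forall a b c, in_graph X k (qcd (a, b, c)) -> P (a, b, c).

Definition s_qseq := N -> (ratio M -> Prop) -> Prop.
Implicit Types x y : s_qseq.

Definition s_dist_lt x i y j e :=
  x i (fun q => y j (fun r => s_qabs (radd q (ropp r)) (fun d => s_qlt d e))).
Definition s_xle x y := s_allqpos (fun e => exists n, forall m, mle n m ->
  x m (fun q => y m (fun r => s_qle q (radd r e)))).
Definition s_xlt x y := s_xle x y /\ ~ (s_xle x y /\ s_xle y x).
Definition s_row X n : s_qseq := fun i => s_entry X (pair n i).

Definition s_is_real X := (forall i, s_val_at X i) /\
  s_allqpos (fun e => exists k, forall m n, mle k m -> mle k n ->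
    s_dist_lt (s_entry X) m (s_entry X) n e).
Definition s_is_real_seq X := (forall n i, s_val_at X (pair n i)) /\
  s_allqpos (fun e => exists k, forall n i j, mle k i -> mle k j ->
    s_dist_lt (s_row X n) i (s_row X n) j e).
Definition s_bounded X := exists B, s_is_real B /\
  forall n, s_xle (fun i P => s_row X n i (fun q => s_qabs q P)) (s_entry B).

Definition s_increasing F := forall i j m n,
  i <! j -> in_graph F i m -> in_graph F j n -> m <! n.
Definition s_converges X F := exists Y, s_is_real Y /\
  s_allqpos (fun e => exists k, forall i m, mle k i -> in_graph F i m ->
    s_xlt (fun j P => s_row X m j (fun q => s_entry Y j (fun r =>
             s_qabs (radd q (ropp r)) P)))
          (fun _ P => P e)).

Definition s_BW := forall X, s_is_real_seq X /\ s_bounded X ->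
  exists F, s_is_fun F /\ (s_increasing F /\ s_converges X F).
Definition s_IPP := forall n c,
  s_is_fun c /\ (forall i j, in_graph c i j -> mle j n) ->
  exists m, mle m n /\ forall k, exists i, k <! i /\ in_graph c i m.
Definition s_COH := forall R, exists C,
  (forall k, exists i, k <! i /\ mmem i C) /\
  forall i, (exists k, forall n, mmem n C /\ ~ in_graph R n i -> mle n k) \/
            (exists k, forall n, mmem n C /\ ~ (n = n /\ ~ in_graph R n i) -> mle n k).

End Semantics.

(** * Satisfaction of the principles in semantic form *)

Section SatIff.

Variables (M : structure) (e : nat -> num M) (s : nat -> sets M).

Lemma sat_AllNum_iff p (P : num M -> Prop) :
  (forall x, sat (scons x e) s p <-> P x) -> sat e s (AllNum p) <-> forall x, P x.
Proof. by move=> H; split=> /= Hp x; apply/H. Qed.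

Lemma sat_AllSet_iff p (P : sets M -> Prop) :
  (forall X, sat e (scons X s) p <-> P X) -> sat e s (AllSet p) <-> forall X, P X.
Proof. by move=> H; split=> /= Hp X; apply/H. Qed.

Lemma sat_ExNum_iff p (P : num M -> Prop) :
  (forall x, sat (scons x e) s p <-> P x) -> sat e s (ExNum p) <-> exists x, P x.
Proof. by move=> H; rewrite sat_ExNum; split=> -[x /H]; exists x. Qed.

Lemma sat_ExSet_iff p (P : sets M -> Prop) :
  (forall X, sat e (scons X s) p <-> P X) -> sat e s (ExSet p) <-> exists X, P X.
Proof. by move=> H; rewrite sat_ExSet; split=> -[x /H]; exists x. Qed.

Variables (p q : form) (P Q : Prop).
Hypotheses (Hp : sat e s p <-> P) (Hq : sat e s q <-> Q).

Lemma sat_And_iff : sat e s (And p q) <-> P /\ Q.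
Proof. by rewrite sat_And Hp Hq. Qed.

Lemma sat_Or_iff : sat e s (Or p q) <-> P \/ Q.
Proof. by rewrite /= Hp Hq; have [] := lem P; tauto. Qed.

Lemma sat_Iff_iff : sat e s (Iff p q) <-> (P <-> Q).
Proof. by rewrite sat_Iff Hp Hq. Qed.

Lemma sat_Imp_iff : sat e s (Imp p q) <-> (P -> Q).
Proof. by rewrite /= Hp Hq. Qed.

Lemma sat_Not_iff : sat e s (Not p) <-> ~ P.
Proof. by rewrite /= Hp. Qed.

End SatIff.

Ltac sat_iff :=
  lazymatch goal with
  | |- sat _ _ (Not _) <-> ~ _ => apply: sat_Not_iff; sat_iff
  | |- sat _ _ (ExNum _) <-> exists _, _ => apply: sat_ExNum_iff => ?; cbn beta; sat_iff
  | |- sat _ _ (ExSet _) <-> exists _, _ => apply: sat_ExSet_iff => ?; cbn beta; sat_iff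
  | |- sat _ _ (Or _ _) <-> (_ \/ _) => apply: sat_Or_iff; sat_iff
  | |- sat _ _ (Iff _ _) <-> (_ <-> _) => apply: sat_Iff_iff; sat_iff
  | |- sat _ _ (And _ _) <-> (_ /\ _) => apply: sat_And_iff; sat_iff
  | |- sat _ _ (AllNum _) <-> _ => apply: sat_AllNum_iff => ?; cbn beta; sat_iff
  | |- sat _ _ (AllSet _) <-> _ => apply: sat_AllSet_iff => ?; cbn beta; sat_iff
  | |- sat _ _ (Imp _ _) <-> _ => apply: sat_Imp_iff; sat_iff
  | _ => exact: iff_refl
  end.

(** [Not], [And], [Or], [Iff], [ExNum] and [ExSet] stay folded, since [sat_iff] recognises the
    connectives by them. *)
Ltac unfold_sat :=
  lazy [close BW IPP COH is_real_seq is_real bounded is_fun strictly_increasing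
    subseq_converges infinite finite diff all_numbers elems section
    val_at entry seq_of row qdist_lt xle xeq xlt xabs xsub qconst
    allq exq allqpos qabs qle qlt qsub qadd qopp qzero qcode qden qpos qneg qaux
    npair eqn ltn mem fneg fimp fconj fdisj fiff alln exn alls exs
    zero one add mul Nat.sub
    s_BW s_IPP s_COH s_is_real_seq s_is_real s_bounded s_is_fun s_increasing
    s_converges s_val_at s_entry s_row s_dist_lt s_xle s_xlt s_qabs s_allqpos
    s_qle s_qlt mle in_graph].

Section SatPrinciples.

Variables (M : rca_model) (e : nat -> num M) (s : nat -> sets M).

Lemma sat_COH : sat e s (close COH) <-> s_COH M.
Proof. unfold_sat; sat_iff. Qed.

Lemma sat_IPP : sat e s (close IPP) <-> s_IPP M.
Proof. unfold_sat; sat_iff. Qed.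

Lemma sat_BW : sat e s (close BW) <-> s_BW M.
Proof. unfold_sat; sat_iff. Qed.

Lemma sat_theorem : (s_COH M /\ s_IPP M <-> s_BW M) -> sat e s (close (StCOH <--> BW)%L2).
Proof.
move=> H.
have : sat e s (Iff (And (close COH) (close IPP)) (close BW)).
  by rewrite sat_Iff sat_And sat_COH sat_IPP sat_BW.
exact.
Qed.

End SatPrinciples.

(** * Reals as sequences in the field of rationals *)

Section Reals.

Variable M : rca_model.
Local Notation N := (num M).
Implicit Types (q r : ratio M) (P : ratio M -> Prop) (X F : sets M).
Implicit Types (x y : s_qseq M) (u w : N -> frac M) (eps : frac M).

Definition val q : frac M := (emb q.1.1 - emb q.1.2) / (emb q.2 + 1).

Lemma den_gt0 (c : N) : 0 < emb c + 1.
Proof. by have := emb_ge0 c; lra. Qed.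

Lemma mleE (m n : N) : mle m n <-> emb m <= emb n.
Proof.
split=> [[mn|->]|mn]; [by mlra|by []|].
by have [|[]] := mlt_total m n; [left|right|move=> nm; exfalso; mlra].
Qed.

Lemma not_mle (m n : N) : ~ mle m n <-> n <! m.
Proof. by rewrite mleE emb_lt ltNge; split=> /negP. Qed.

Lemma mle_refl (n : N) : mle n n. Proof. by right. Qed.

Lemma mle_trans (m n k : N) : mle m n -> mle n k -> mle m k.
Proof. by rewrite !mleE; exact: le_trans. Qed.

Lemma mle_add_l (m n : N) : mle m (m + n).
Proof. by apply/mleE; rewrite embD; have := emb_ge0 n; lra. Qed.

Lemma mle_add_r (m n : N) : mle n (m + n).
Proof. by apply/mleE; rewrite embD; have := emb_ge0 m; lra. Qed.

Lemma s_qleE q r : s_qle q r <-> val q <= val r.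
Proof.
rewrite /s_qle mleE /val ler_pdivrMr ?den_gt0 // mulrAC ler_pdivlMr ?den_gt0 //.
by rewrite !(embD, embM, emb1); split=> H; lra.
Qed.

Lemma s_qltE q r : s_qlt q r <-> val q < val r.
Proof.
rewrite /s_qlt emb_lt /val ltr_pdivrMr ?den_gt0 // mulrAC ltr_pdivlMr ?den_gt0 //.
by rewrite !(embD, embM, emb1); split=> H; lra.
Qed.

Lemma val0 : val (0, 0, 0) = 0.
Proof. by rewrite /val subrr mul0r. Qed.

Lemma val_add q r : val (radd q r) = val q + val r.
Proof.
have den0 (c : N) : emb c + 1 != 0 by rewrite gt_eqF // den_gt0.
rewrite /val (addf_div _ _ (den0 _) (den0 _)) /radd /= !(embD, embM, emb1).
move: (emb q.1.1) (emb q.1.2) (emb q.2) (emb r.1.1) (emb r.1.2) (emb r.2).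
move=> a b c a' b' c'.
have -> : (a - b) * (c' + 1) + (a' - b') * (c + 1) =
  a * (c' + 1) + a' * (c + 1) - (b * (c' + 1) + b' * (c + 1)) by ring.
have -> : (c + 1) * (c' + 1) = c * c' + c + c' + 1 by ring.
by [].
Qed.

Lemma val_opp q : val (ropp q) = - val q.
Proof. by rewrite /val /= -mulNr opprB. Qed.

Lemma val_surj (v : frac M) : exists q, val q = v.
Proof. by have [a [b [c ->]]] := frac_val v; exists (a, b, c). Qed.

Lemma qcd_inj q r : qcd q = qcd r -> q = r.
Proof.
case: q r => [[a b] c] [[a' b'] c'] /pair_inj[/pair_inj[/= -> ->] /= ->] //.
Qed.

Lemma s_allqposE P (Phi : frac M -> Prop) : (forall q, P q <-> Phi (val q)) ->
  s_allqpos P <-> forall eps, 0 < eps -> Phi eps.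
Proof.
move=> PPhi; split=> H.
  move=> eps; have [q <-] := val_surj eps => q0; apply/PPhi.
  by move: q q0 => [[a b] c] q0; apply: H; apply/s_qltE; rewrite val0.
by move=> a b c /s_qltE; rewrite val0 => /H/PPhi.
Qed.

Lemma s_qabsE q P (Phi : frac M -> Prop) : (forall q, P q <-> Phi (val q)) ->
  s_qabs q P <-> Phi `|val q|.
Proof.
move=> PPhi; rewrite /s_qabs s_qleE s_qltE val0 !PPhi val_opp.
split=> [[Hp Hn]|H].
  by have [H0|H0] := lerP 0 (val q); [rewrite ger0_norm|rewrite ltr0_norm]; auto.
by split=> H0; move: H; [rewrite ger0_norm|rewrite ltr0_norm].
Qed.

(* [x] and [u] are the same sequence of rationals, for predicates that do not
   distinguish between codes of the same rational. *)
Definition reps x u := forall m P (Phi : frac M -> Prop),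
  (forall q, P q <-> Phi (val q)) -> x m P <-> Phi (u m).

Definition has_val X k q := forall j, in_graph X k j <-> j = qcd q.

Lemma s_entryE X k q P : has_val X k q -> s_entry X k P <-> P q.
Proof.
move=> Xq; split=> [H|Pq a b c /Xq/qcd_inj -> //].
by case: q Xq => [[a b] c] Xq; apply: H; apply/Xq.
Qed.

Lemma reps_seq X (z : N -> ratio M) : (forall i, has_val X i (z i)) ->
  reps (s_entry X) (fun i => val (z i)).
Proof. by move=> Xz m P Phi PPhi; rewrite (s_entryE _ (Xz m)). Qed.

Lemma reps_row X n (z : N -> ratio M) : (forall i, has_val X (pair n i) (z i)) ->
  reps (s_row X n) (fun i => val (z i)).
Proof. by move=> Xz m P Phi PPhi; rewrite /s_row (s_entryE _ (Xz m)). Qed.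

Lemma reps_abs x u : reps x u -> reps (fun i P => x i (fun q => s_qabs q P)) (fun i => `|u i|).
Proof.
move=> xu m P Phi PPhi; apply: (xu m _ (fun v => Phi `|v|)) => q.
exact: s_qabsE.
Qed.

Lemma reps_abs_sub x y u w : reps x u -> reps y w ->
  reps (fun i P => x i (fun q => y i (fun r => s_qabs (radd q (ropp r)) P)))
       (fun i => `|u i - w i|).
Proof.
move=> xu yw m P Phi PPhi; apply: (xu m _ (fun v => Phi `|v - w m|)) => q.
apply: (yw m _ (fun v => Phi `|val q - v|)) => r.
by rewrite (s_qabsE _ PPhi) val_add val_opp.
Qed.

Lemma reps_const q : reps (fun _ P => P q) (fun _ => val q).
Proof. by move=> m P Phi. Qed.

Lemma s_dist_ltE x i y j e u w : reps x u -> reps y w ->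
  s_dist_lt x i y j e <-> `|u i - w j| < val e.
Proof.
move=> xu yw; apply: (xu i _ (fun v => `|v - w j| < val e)) => q.
apply: (yw j _ (fun v => `|val q - v| < val e)) => r.
rewrite (s_qabsE _ (Phi := fun v => v < val e)) ?val_add ?val_opp // => d.
exact: s_qltE.
Qed.

Definition kle u w := forall eps, 0 < eps -> exists n, forall m, mle n m -> u m <= w m + eps.

Lemma forall_iff (T : Type) (P Q : T -> Prop) : (forall t, P t <-> Q t) ->
  (forall t, P t) <-> (forall t, Q t).
Proof. by move=> PQ; split=> H t; apply/PQ. Qed.

Lemma exists_iff (T : Type) (P Q : T -> Prop) : (forall t, P t <-> Q t) ->
  (exists t, P t) <-> (exists t, Q t).
Proof. by move=> PQ; split=> -[t /PQ Ht]; exists t. Qed.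

Lemma s_xleE x y u w : reps x u -> reps y w -> s_xle x y <-> kle u w.
Proof.
move=> xu yw; apply: (s_allqposE (Phi := fun eps => exists n, forall m, mle n m ->
  u m <= w m + eps)) => e.
apply: exists_iff => n; apply: forall_iff => m; apply: forall_iff => _.
apply: (xu m _ (fun v => v <= w m + val e)) => q.
apply: (yw m _ (fun v => val q <= v + val e)) => r.
by rewrite s_qleE val_add.
Qed.

Lemma s_xltE x y u w : reps x u -> reps y w ->
  s_xlt x y <-> kle u w /\ ~ (kle u w /\ kle w u).
Proof. by move=> xu yw; rewrite /s_xlt !(s_xleE xu yw) (s_xleE yw xu). Qed.

Definition cauchy u := forall eps, 0 < eps -> exists k, forall m n,
  mle k m -> mle k n -> `|u m - u n| < eps.

Lemma s_cauchyE x u : reps x u ->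
  s_allqpos (fun e => exists k, forall m n, mle k m -> mle k n ->
    s_dist_lt x m x n e) <-> cauchy u.
Proof.
move=> xu; apply: (s_allqposE (Phi := fun eps => exists k, forall m n, mle k m -> mle k n ->
  `|u m - u n| < eps)) => e.
apply: exists_iff => k; do 2 (apply: forall_iff => ?); do 2 (apply: forall_iff => _).
exact: s_dist_ltE.
Qed.

Definition unif_cauchy (v : N -> N -> frac M) := forall eps, 0 < eps ->
  exists k, forall n i j, mle k i -> mle k j -> `|v n i - v n j| < eps.

Lemma s_unif_cauchyE (x : N -> s_qseq M) v : (forall n, reps (x n) (v n)) ->
  s_allqpos (fun e => exists k, forall n i j, mle k i -> mle k j ->
    s_dist_lt (x n) i (x n) j e) <-> unif_cauchy v.
Proof.
move=> xv; apply: (s_allqposE (Phi := fun eps => exists k, forall n i j,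
  mle k i -> mle k j -> `|v n i - v n j| < eps)) => e.
apply: exists_iff => k; do 3 (apply: forall_iff => ?); do 2 (apply: forall_iff => _).
exact: s_dist_ltE.
Qed.

Lemma s_is_realP X : s_is_real X ->
  exists z, (forall i, has_val X i (z i)) /\ cauchy (fun i => val (z i)).
Proof.
move=> [HX Hc].
have /choice[z Hz] i : exists q, has_val X i q.
  by have [a [b [c H]]] := HX i; exists (a, b, c).
exists z; split=> //; exact/(s_cauchyE (reps_seq Hz)).
Qed.

Lemma has_val_at X k q : has_val X k q -> s_val_at X k.
Proof. by case: q => [[a b] c] H; exists a, b, c. Qed.

Lemma s_is_real_intro X z : (forall i, has_val X i (z i)) ->
  cauchy (fun i => val (z i)) -> s_is_real X.
Proof.
move=> Xz cz; split; first by move=> i; exact: has_val_at (Xz i).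
exact/(s_cauchyE (reps_seq Xz)).
Qed.

Lemma s_convergesE X F v : (forall n, reps (s_row X n) (v n)) ->
  s_converges X F <-> exists Y z, [/\ forall i, has_val Y i (z i),
    cauchy (fun i => val (z i)) &
    forall eps, 0 < eps -> exists k, forall i m, mle k i -> in_graph F i m ->
      kle (fun l => `|v m l - val (z l)|) (fun=> eps) /\
      ~ (kle (fun l => `|v m l - val (z l)|) (fun=> eps) /\
         kle (fun=> eps) (fun l => `|v m l - val (z l)|))].
Proof.
move=> Xv; have conv Y z : (forall i, has_val Y i (z i)) -> forall e,
    (exists k, forall i m, mle k i -> in_graph F i m ->
      s_xlt (fun j P => s_row X m j (fun q => s_entry Y j (fun r =>
             s_qabs (radd q (ropp r)) P))) (fun _ P => P e)) <->
    (exists k, forall i m, mle k i -> in_graph F i m ->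
      kle (fun l => `|v m l - val (z l)|) (fun=> val e) /\
      ~ (kle (fun l => `|v m l - val (z l)|) (fun=> val e) /\
         kle (fun=> val e) (fun l => `|v m l - val (z l)|))).
  move=> Yz e; apply: exists_iff => k; apply: forall_iff => i; apply: forall_iff => m.
  do 2 (apply: forall_iff => _).
  exact: s_xltE (reps_abs_sub (Xv m) (reps_seq Yz)) (reps_const e).
split=> [[Y [/s_is_realP[z [Yz cz]] H]]|[Y [z [Yz cz H]]]].
  by exists Y, z; split=> //; apply/(s_allqposE (conv Y z Yz)).
exists Y; split; first exact: s_is_real_intro cz.
exact: (s_allqposE (conv Y z Yz)).2 H.
Qed.

Lemma comprehension_dec2 (R : N -> N -> Prop) : dec2 R ->
  exists X, forall i j, in_graph X i j <-> R i j.
Proof.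
move=> DR; have [|X HX] := @comprehension_D1 M (fun p => exists i, i <! p + 1 /\
    exists j, j <! p + 1 /\ (p = pair i j /\ R i j)).
  by rewrite /dec1; solve_D1.
exists X => i j; rewrite /in_graph HX; split.
  by move=> [i' [_ [j' [_ [/pair_inj[-> ->] ?]]]]].
move=> Rij; exists i; split; first exact: le_pair_l.
by exists j; split=> //; exact: le_pair_r.
Qed.

Lemma graph_set (f : N -> N) : rec1 f -> exists F, forall i j, in_graph F i j <-> j = f i.
Proof.
by move=> rf; apply: (comprehension_dec2 (R := fun i j => j = f i)); rewrite /dec2; solve_D1.
Qed.

(** The graph is a set of the model, hence a legitimate parameter, so the function may enter
    induction and comprehension. *)
Lemma fun_of_graph F : s_is_fun F ->
  exists2 f, rec1 f & forall i k, in_graph F i k <-> k = f i.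
Proof.
move=> /choice[f Hf]; exists f => //.
rewrite /rec1 /rec; apply: (S1_iff (P := fun e => mmem (pair (e 1%N) (e 0%N)) F)).
  by move=> e; exact: Hf.
by solve_S1.
Qed.

Lemma archimedean (v : frac M) : exists n : N, v <= emb n.
Proof.
have [a [b [c ->]]] := frac_val v; exists a.
rewrite ler_pdivrMr ?den_gt0 //.
by have := emb_ge0 a; have := emb_ge0 b; have := emb_ge0 c; nra.
Qed.

Lemma small_inverse eps : 0 < eps -> exists d : N, (emb d + 1)^-1 <= eps.
Proof.
move=> e0; have [d Hd] := archimedean eps^-1; exists d.
rewrite -[eps]invrK lef_pV2 ?posrE ?invr_gt0 ?den_gt0 //; lra.
Qed.

End Reals.

(** * From Bolzano-Weierstrass to cohesiveness *)

Section FromBW.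

Variable M : rca_model.
Local Notation N := (num M).

Definition increasing (f : N -> N) := forall i j, i <! j -> f i <! f j.

Lemma increasing_ge f : rec1 f -> increasing f -> forall i, mle i (f i).
Proof.
move=> rf incf i; suff : ~ f i <! i.
  by move=> H; apply: contrapT => /not_mle.
elim/S1_ind: i; first by solve_S1.
  exact: ltm0.
move=> i IH fi; apply: IH; have := incf i (i + 1) _.
by have H : i <! i + 1 by [mlra]; move=> /(_ H) H'; mlra.
Qed.

Lemma val_nat (n : N) : val (n, 0, 0) = emb n.
Proof. by rewrite /val /= emb0 subr0 add0r divr1. Qed.

(** The form in which both applications use Bolzano-Weierstrass: the limit is eliminated by the
    triangle inequality, leaving closeness of late terms to each other. *)
Lemma BW_subsequence (a b c : N -> N -> N) (B : N) : s_BW M ->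
  rec2 a -> rec2 b -> rec2 c -> let v n i := val (a n i, b n i, c n i) in
  unif_cauchy v -> (forall n i, `|v n i| <= emb B) ->
  exists f, [/\ rec1 f, increasing f & forall eps, 0 < eps -> exists k,
    forall i j, mle k i -> mle k j -> exists l0, forall l, mle l0 l ->
    `|v (f i) l - v (f j) l| <= eps].
Proof.
move=> BW ra rb rc v ucv vB.
have [|X HX] := @comprehension_dec2 M (fun p j => exists n, n <! p + 1 /\
    exists i, i <! p + 1 /\ (p = pair n i /\
      j = pair (pair (a n i) (b n i)) (c n i))).
  by rewrite /dec2; solve_D1.
have Xv n i : has_val X (pair n i) (a n i, b n i, c n i).
  move=> j; rewrite HX; split=> [[n' [_ [i' [_ [/pair_inj[-> ->] ->]]]]] //|->].
  exists n; split; first exact: le_pair_l.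
  by exists i; split; first exact: le_pair_r.
have rowv n : reps (s_row X n) (v n) by exact: reps_row.
have [|Y HY] := @graph_set M (fun=> qcd (B, 0, 0)); first by rewrite /rec1; solve_rec.
have [|F [funF [incF /(s_convergesE _ rowv)[Y' [z [Yz cz conv]]]]]] := BW X.
  split; first by split; [move=> n i; exact: has_val_at (Xv n i)|exact/s_unif_cauchyE].
  exists Y; split.
    apply: (s_is_real_intro (z := fun=> (B, 0, 0))) => // eps e0.
    by exists 0 => m n _ _; rewrite subrr normr0.
  move=> n; apply/(s_xleE (reps_abs (rowv n)) (reps_seq (z := fun=> (B, 0, 0)) HY)).
  move=> eps e0; exists 0 => m _; rewrite val_nat.
  by have := vB n m; lra.
have [f rf Hf] := fun_of_graph funF.
exists f; split=> //.
  by move=> i j ij; apply: incF ij _ _; exact/Hf.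
have Ff i : in_graph F i (f i) by exact/Hf.
(* Each of the two distances to the limit is at most [eps / 4], up to a slack of [eps / 4] in the
   order of reals. *)
move=> eps e0; have [|k Hk] := conv (eps / 4); first by lra.
exists k => i j /Hk/(_ (Ff i))[Hi _] /Hk/(_ (Ff j))[Hj _].
have [|li Hli] := Hi (eps / 4); first by lra.
have [|lj Hlj] := Hj (eps / 4); first by lra.
exists (li + lj) => l lijl.
move: (Hli l (mle_trans (mle_add_l li lj) lijl)) (Hlj l (mle_trans (mle_add_r li lj) lijl)).
move: (v (f i) l) (v (f j) l) (val (z l)) => vi vj zl Hvi Hvj.
rewrite ler_norml in Hvi; rewrite ler_norml in Hvj; rewrite ler_norml.
by case/andP: Hvi => ? ?; case/andP: Hvj => ? ?; apply/andP; split; lra.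
Qed.

Lemma IPP_of_BW : s_BW M -> s_IPP M.
Proof.
move=> BW n c [func hn]; have [h rh Hh] := fun_of_graph func.
have {}hn i : mle (h i) n by apply: hn; exact/Hh.
have [|||||f [rf incf Hf]] := @BW_subsequence (fun i _ => h i) (fun _ _ => 0) (fun _ _ => 0) n BW.
- by rewrite /rec2; solve_rec.
- by rewrite /rec2; solve_rec.
- by rewrite /rec2; solve_rec.
- move=> eps e0; exists 0 => m i j _ _; by rewrite subrr normr0.
- by move=> m _; rewrite val_nat ger0_norm ?emb_ge0 //; exact/mleE.
(* Distinct numbers are at least 1 apart, so distance at most 1/2 forces equal colours. *)
have [|k Hk] := Hf (1 / 2); first by lra.
have fk j : mle k j -> h (f j) = h (f k).
  move=> kj; have [l0 /(_ l0 (mle_refl l0))] := Hk j k kj (mle_refl k).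
  rewrite !val_nat ler_norml => /andP[H1 H2].
  by have [H|[//|H]] := mlt_total (h (f j)) (h (f k)); exfalso; mlra.
exists (h (f k)); split=> // i; exists (f (k + i + 1)); split; last first.
  by apply/Hh; rewrite fk //; apply/mleE; emb_facts; lra.
by have /mleE H := increasing_ge rf incf (k + i + 1); mlra.
Qed.

Variable R : sets M.
Let chi (i n : N) : N := if pselect (in_graph R n i) then 1 else 0.

Lemma rec_chi : rec2 chi.
Proof.
rewrite /rec2 /rec; apply: (S1_iff (P := fun e =>
  (mmem (pair (e 2%N) (e 1%N)) R /\ e 0%N = 1) \/
  (~ mmem (pair (e 2%N) (e 1%N)) R /\ e 0%N = 0))); last by solve_S1.
by move=> e; rewrite /chi; case: pselect => H; split=> [[[? ->]|[? ->]]|->] //;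
  [left|right].
Qed.

(* [s n i / (t i + 1)] is the sum of the first [i] ternary digits [chi j n], [j < i]. *)
Lemma digits : exists (s : N -> N -> N) (t : N -> N), [/\ rec2 s, rec1 t,
  forall n, s n 0 = 0,
  forall n i, s n (i + 1) = s n i + s n i + s n i + chi i n &
  t 0 = 0 /\ forall i, t (i + 1) = t i + t i + t i + 1 + 1].
Proof.
have rchi := rec_chi.
have [||s [rs s0 sS]] := @primitive_recursion M (fun=> 0)
  (fun n i x => x + x + x + chi i n).
- by rewrite /rec1; solve_rec.
- by rewrite /rec3; solve_rec.
have [||t [rt t0 tS]] := @primitive_recursion M (fun=> 0) (fun _ _ x => x + x + x + 1 + 1).
- by rewrite /rec1; solve_rec.
- by rewrite /rec3; solve_rec.
exists s, (t 0); split=> //.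
by rewrite /rec1; solve_rec.
Qed.

Lemma chi01 i n : chi i n = 0 \/ chi i n = 1.
Proof. by rewrite /chi; case: pselect; [right|left]. Qed.

Lemma mle_ex (m n : N) : mle m n -> exists d, n = m + d.
Proof.
by move=> [/ltm_ex[z <-]|->]; [exists (z + 1); rewrite addrA|exists 0; rewrite addr0].
Qed.

Lemma cohesive_of_BW : s_BW M -> exists C : sets M,
  (forall k, exists i, k <! i /\ mmem i C) /\
  forall i, (exists k, forall n, mmem n C /\ ~ in_graph R n i -> mle n k) \/
    (exists k, forall n, mmem n C /\ ~ (n = n /\ ~ in_graph R n i) -> mle n k).
Proof.
move=> BW; have [s [t [rs rt s0 sS [t0 tS]]]] := digits.
(* The left and right ends of the intervals from s_j / 3^j to (s_j + 1/2) / 3^j are monotone,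
   because 1/3 + 1/9 + ... = 1/2. Fractions are cleared so that the claim about numbers can be
   proved by induction. *)
have nested n j d : ~ s n (j + d) * (t j + 1) <! s n j * (t (j + d) + 1) /\
  ~ (s n j + s n j + 1) * (t (j + d) + 1) <! (s n (j + d) + s n (j + d) + 1) * (t j + 1).
  elim/S1_ind: d; first by solve_S1.
    by rewrite addr0; split; mlra.
  move=> d [H1 H2]; rewrite addrA sS tS.
  by have [->|->] := chi01 (j + d) n; split; mlra.
have tge i : ~ t i <! i.
  by elim/S1_ind: i; [solve_S1|exact: ltm0|move=> i H; rewrite tS; mlra].
(* [P i] is 3^i, hidden behind a variable so that the arithmetic tactics treat it as an atom. *)
clear t0; have [P PE] : exists P : N -> frac M, forall i, emb (t i) + 1 = P i by eexists.
have P0 i : 0 < P i by rewrite -PE den_gt0.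
have [v vdef] : exists v : N -> N -> frac M, forall n i, val (s n i, 0, t i) = v n i.
  by eexists.
have vE n i : v n i = emb (s n i) * (P i)^-1 by rewrite -vdef /val /= emb0 subr0 PE.
have vbd n i j : mle j i -> v n j <= v n i /\ v n i <= v n j + (P j)^-1 / 2.
  move=> /mle_ex[d ->]; have [H1 H2] := nested n j d; move: H1 H2.
  rewrite !emb_lt => /negP + /negP; rewrite -!leNgt !(embM, embD, emb1) !PE => H1 H2.
  rewrite !vE; split; first by rewrite ler_pdivrMr // mulrAC ler_pdivlMr.
  have -> : emb (s n j) * (P j)^-1 + (P j)^-1 / 2 = (emb (s n j) + 1 / 2) * (P j)^-1.
    by rewrite mulrDl mul1r [_^-1 / 2]mulrC.
  rewrite ler_pdivrMr // mulrAC ler_pdivlMr //.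
  by have := P0 j; have := P0 (j + d); lra.
have Pinv d : (P d)^-1 <= (emb d + 1)^-1.
  rewrite lef_pV2 ?posrE ?den_gt0 // -PE lerD2r.
  by have := tge d; rewrite emb_lt => /negP; rewrite -leNgt.
have [||||f [rf incf Hf]] := @BW_subsequence s (fun _ _ => 0) (fun _ => t) 1 BW rs.
- by rewrite /rec2; solve_rec.
- by rewrite /rec2; solve_rec.
- move=> eps e0; have [d Hd] := small_inverse e0.
  exists d => n i j /(vbd n)[Hi1 Hi2] /(vbd n)[Hj1 Hj2].
  have := Pinv d; rewrite /= !vdef ltr_norml => ?; apply/andP; split; lra.
- move=> n i; rewrite vdef emb1 ler_norml.
  have [|H1 H2] := vbd n i 0; first by apply/mleE; rewrite emb0 emb_ge0.
  have v0 : v n 0 = 0 by rewrite vE s0 emb0 mul0r.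
  have := Pinv 0; rewrite emb0 add0r invr1 => ?; apply/andP; split; lra.
have const j : exists k, forall i, mle k i -> s (f i) j = s (f k) j.
  (* Different prefixes of length [j] keep the values at least half of 3^-j apart, so a quarter of
     3^-j forces equal prefixes. *)
  have [|k Hk] := Hf ((P j)^-1 / 4); first by rewrite divr_gt0 ?invr_gt0.
  exists k => i ki; have [l0 Hl] := Hk i k ki (mle_refl k).
  have := Hl (l0 + j) (mle_add_l l0 j); rewrite !vdef ler_norml => /andP[H1 H2].
  have [Hi1 Hi2] := vbd (f i) _ _ (mle_add_r l0 j).
  have [Hk1 Hk2] := vbd (f k) _ _ (mle_add_r l0 j).
  have y0 : 0 < (P j)^-1 by rewrite invr_gt0.
  rewrite !(vE _ j) in Hi1 Hi2 Hk1 Hk2.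
  move: (P j)^-1 (v (f i) _) (v (f k) _) y0 Hi1 Hi2 Hk1 Hk2 H1 H2 => y vi vk y0.
  move=> Hi1 Hi2 Hk1 Hk2 H1 H2; have sep (x z : N) : x <! z -> emb x * y + y <= emb z * y.
    by move=> /emb_leS xz; rewrite -{2}[y]mul1r -mulrDl ler_pM2r.
  have [/sep H|[//|/sep H]] := mlt_total (s (f i) j) (s (f k) j); exfalso; lra.
(* Since [k] is at most [f k], membership in the range of [f] is a bounded search and so Delta_1. *)
have [|C HC] := @comprehension_D1 M (fun m => exists k, k <! m + 1 /\ m = f k).
  by rewrite /dec1; solve_D1.
have fC k : mmem (f k) C.
  apply/HC; exists k; split=> //.
  by have /mleE H := increasing_ge rf incf k; mlra.
exists C; split.
  move=> k; exists (f (k + 1)); split=> //.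
  by have /mleE H := increasing_ge rf incf (k + 1); mlra.
(* Digit [i] equals s_(i+1) - 3 s_i, and both prefixes are eventually constant along [f]. *)
move=> i; have [k1 H1] := const i; have [k2 H2] := const (i + 1).
set k := k1 + k2.
have chi_const l : mle k l -> chi i (f l) = chi i (f k).
  move=> kl; have := H2 l (mle_trans (mle_add_r k1 k2) kl).
  rewrite -(H2 k (mle_add_r k1 k2)) !sS.
  rewrite (H1 l (mle_trans (mle_add_l k1 k2) kl)) (H1 k (mle_add_l k1 k2)) => E.
  by clear -E; mlra.
have far n : mmem n C -> ~ mle n (f k) -> exists2 l, mle k l & n = f l.
  move=> /HC[l [_ ->]] /not_mle kl; exists l => //.
  by apply: contrapT => /not_mle /incf lk; mlra.
have E n : chi i n = if pselect (in_graph R n i) then 1 else 0 by [].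
have neq01 : 0 <> 1 :> N by apply/eqP; rewrite eq_sym oner_eq0.
have [kR|kR] := lem (in_graph R (f k) i); [left|right]; exists (f k) => n [nC nR];
    apply: contrapT => /(far n nC)[l /chi_const + nl]; rewrite -nl !E.
  by case: pselect => // ?; case: pselect.
case: pselect => [?|nR']; last by case: nR.
by case: pselect => // ? /esym.
Qed.

End FromBW.

(** * From cohesiveness to Bolzano-Weierstrass *)

Lemma dist_tri3 (F : realFieldType) (a b c d e : F) :
  `|a - b| < e / 3 -> `|b - c| < e / 3 -> `|d - c| < e / 3 -> `|a - d| < e.
Proof.
rewrite !ltr_norml => /andP[? ?] /andP[? ?] /andP[? ?]; apply/andP; split; lra.
Qed.

Section FromStCOH.

Variable M : rca_model.
Local Notation N := (num M).

(** Taking the least witness makes the graph of the choice function definable. *)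
Lemma least_choice (Q : N -> N -> Prop) : dec2 Q -> (forall n, exists y, Q n y) ->
  exists2 g, rec1 g & forall n, Q n (g n) /\ forall z, z <! g n -> ~ Q n z.
Proof.
move=> DQ exQ.
have /choice[g Hg] n : exists y, Q n y /\ forall z, z <! y -> ~ Q n z.
  by apply: least; [rewrite /dec1; solve_D1|exact: exQ].
exists g => //; apply: (S1_iff (P := fun e => Q (e 1%N) (e 0%N) /\
    forall z, z <! e 0%N -> ~ Q (e 1%N) z)); last by solve_S1.
move=> e; split=> [[Qe He]|->]; last exact: Hg.
have [Qg Hg'] := Hg (e 1%N).
by have [/Hg'|[//|/He]] := mlt_total (e 0%N) (g (e 1%N)).
Qed.

Lemma enumeration C : (forall k, exists i, k <! i /\ mmem i C) ->
  exists f : N -> N, [/\ rec1 f, increasing f & forall i, mmem (f i) C].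
Proof.
move=> infC; have [|next rnext Hnext] := @least_choice (fun n y => n <! y /\ mmem y C) _ infC.
  by rewrite /dec2; solve_D1.
have [||F [rF F0 FS]] := @primitive_recursion M (fun=> next 0) (fun _ _ x => next x).
- by rewrite /rec1; solve_rec.
- by rewrite /rec3; solve_rec.
exists (F 0); split.
- by rewrite /rec1; solve_rec.
- move=> i j /ltm_ex[z <-]; elim/S1_ind: z; first by solve_S1.
    by rewrite addr0 FS; have [[]] := Hnext (F 0 i).
  move=> z IH; rewrite addrA FS; have [[H _] _] := Hnext (F 0 (i + z + 1)).
  by mlra.
- move=> i; elim/S1_ind: i; first by solve_S1.
    by rewrite F0; have [[]] := Hnext 0.
  by move=> i _; rewrite FS; have [[]] := Hnext (F 0 i).
Qed.

Lemma cohesive_set (R : N -> N -> Prop) : s_COH M -> dec2 R -> exists C : sets M,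
  (forall k, exists i, k <! i /\ mmem i C) /\
  forall p, (exists k, forall n, mmem n C -> k <! n -> R p n) \/
            (exists k, forall n, mmem n C -> k <! n -> ~ R p n).
Proof.
move=> COH DR.
have [|X HX] := @comprehension_dec2 M (fun n p => R p n); first by rewrite /dec2; solve_D1.
have [C [infC cohC]] := COH X; exists C; split=> // p.
case: (cohC p) => -[k Hk]; [left|right]; exists k => n nC /not_mle nk.
  by apply: contrapT => nR; apply: nk; apply: Hk; split=> // /HX.
by move=> Rpn; apply: nk; apply: Hk; split=> // -[_]; apply; apply/HX.
Qed.

(** Each component of the rational entry has a Sigma_1 graph: quantify the other two components
    existentially. *)
Lemma row_values X : (forall n i, s_val_at X (pair n i)) ->
  exists a b c : N -> N -> N, [/\ rec2 a, rec2 b, rec2 c &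
    forall n i, has_val X (pair n i) (a n i, b n i, c n i)].
Proof.
move=> HX; have /choice[x Hx] (p : N * N) : exists q, has_val X (pair p.1 p.2) q.
  by have [a [b [c H]]] := HX p.1 p.2; exists (a, b, c).
have Hx' n i : has_val X (pair n i) (x (n, i)) := Hx (n, i).
have key n i a b c : mmem (pair (pair n i) (pair (pair a b) c)) X <-> x (n, i) = (a, b, c).
  rewrite -[mmem _ _]/(in_graph X (pair n i) (qcd (a, b, c))) (Hx' n i).
  by split=> [/qcd_inj|->].
exists (fun n i => (x (n, i)).1.1), (fun n i => (x (n, i)).1.2), (fun n i => (x (n, i)).2).
split; last by move=> n i j; rewrite (Hx' n i); case: (x (n, i)) => [[]].
- apply: (S1_iff (P := fun e => exists b c, mmem (pair (pair (e 1%N) (e 2%N))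
    (pair (pair (e 0%N) b) c)) X)); last by solve_S1.
  move=> e; split=> [[b [c /key ->]] //|E].
  exists (x (e 1%N, e 2%N)).1.2, (x (e 1%N, e 2%N)).2; apply/key; rewrite E.
  by case: (x _) => [[]].
- apply: (S1_iff (P := fun e => exists b c, mmem (pair (pair (e 1%N) (e 2%N))
    (pair (pair b (e 0%N)) c)) X)); last by solve_S1.
  move=> e; split=> [[b [c /key ->]] //|E].
  exists (x (e 1%N, e 2%N)).1.1, (x (e 1%N, e 2%N)).2; apply/key; rewrite E.
  by case: (x _) => [[]].
- apply: (S1_iff (P := fun e => exists b c, mmem (pair (pair (e 1%N) (e 2%N))
    (pair (pair b c) (e 0%N))) X)); last by solve_S1.
  move=> e; split=> [[b [c /key ->]] //|E].
  exists (x (e 1%N, e 2%N)).1.1, (x (e 1%N, e 2%N)).1.2; apply/key; rewrite E.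
  by case: (x _) => [[]].
Qed.

(** A bound on a real controls its entries only from some index on, which may depend on the real;
    the uniform Cauchy condition supplies an index [i0] for all rows. *)
Lemma uniform_bound (v : N -> N -> frac M) (w : N -> frac M) :
  unif_cauchy v -> cauchy w -> (forall n, kle (fun i => `|v n i|) w) ->
  exists B i0, forall n i, mle i0 i -> `|v n i| <= emb B.
Proof.
move=> ucv cw vw.
have [i0 Hi0] := ucv 1 ltr01; have [k Hk] := cw 1 ltr01.
(* One unit each for moving along the row, for the slack in the order of reals, and for moving along
   [w]. *)
have [B HB] := archimedean (w k + 3); exists B, i0 => n i ii0.
have [l Hl] := vw n 1 ltr01.
pose m := i0 + k + l.
have mi0 : mle i0 m by exact: mle_trans (mle_add_l i0 k) (mle_add_l _ l).
have mk : mle k m by exact: mle_trans (mle_add_r i0 k) (mle_add_l _ l).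
move: (Hi0 n i m ii0 mi0) (Hk m k mk (mle_refl k)) (Hl m (mle_add_r _ l)) HB.
move: (v n i) (v n m) (w m) (w k) (emb B) => x y z t b H1 H2 H3 H4.
rewrite ltr_norml in H1; rewrite ltr_norml in H2; rewrite ler_norml in H3.
case/andP: H1 => ? ?; case/andP: H2 => ? ?; case/andP: H3 => ? ?.
by rewrite ler_norml; apply/andP; split; lra.
Qed.

(** The grid starts at -B with mesh 1 / (d + 1); the shift sits in the negative part of the code. *)
Lemma val_grid (B d j : N) :
  val (j, B * (d + 1), d) = emb j * (emb d + 1)^-1 - emb B.
Proof.
by rewrite /val /= embM embD emb1 mulrBl mulfK // gt_eqF ?den_gt0.
Qed.

(* The index of the cell of the grid of mesh [1 / (d + 1)] that contains [u l] is a
   bounded colouring; a colour that occurs infinitely often is eventually constant,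
   since eventually each grid point lies on one side of [u l]. *)
Lemma cauchy_of_cohesive (a b c : N -> N) (B : N) : s_IPP M ->
  rec1 a -> rec1 b -> rec1 c -> let u l := val (a l, b l, c l) in
  (forall l, `|u l| <= emb B) ->
  (forall q, (exists k, forall l, mle k l -> u l < val q) \/
             (exists k, forall l, mle k l -> ~ u l < val q)) ->
  cauchy u.
Proof.
move=> IPP ra rb rc u' uB coh.
have [u udef] : exists u : N -> frac M, forall l, val (a l, b l, c l) = u l by eexists.
have {}uB l : `|u l| <= emb B by rewrite -udef; exact: uB.
have {}coh q : (exists k, forall l, mle k l -> u l < val q) \/
    (exists k, forall l, mle k l -> ~ u l < val q).
  by case: (coh q) => -[k Hk]; [left|right]; exists k => l; rewrite -udef; exact: Hk.
suff : cauchy u by move=> cu eps /cu[k Hk]; exists k => m n; rewrite /u' !udef; exact: Hk.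
move=> eps /small_inverse[d Hd]; set h := (emb d + 1)^-1 in Hd.
have h0 : 0 < h by rewrite /h invr_gt0 den_gt0.
pose Q l j := s_qlt (a l, b l, c l) (j, B * (d + 1), d).
have QE l j : Q l j <-> u l < emb j * h - emb B by rewrite /Q s_qltE udef val_grid.
have DQ : dec2 Q by rewrite /dec2 /Q /s_qlt /=; solve_D1.
(* Grid point [J] is B + 1 / (d + 1), above every [u l], so the colours are bounded by [J]. *)
pose J := B * (d + 1) + B * (d + 1) + 1.
have QJ l : Q l J.
  apply/QE; move: (uB l); rewrite ler_norml => /andP[_ ul].
  rewrite /J !(embD, embM, emb1) !mulrDl mul1r mulfK ?gt_eqF ?den_gt0 //.
  by move: (u l) (emb B) ul => x y ?; lra.
have [g rg Hg] := least_choice DQ (fun l => ex_intro _ J (QJ l)).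
have [G HG] := graph_set rg.
have [|j [_ infj]] := IPP J G.
  split; first by move=> i; exists (g i) => k; exact: HG.
  move=> i j /HG ->; apply: contrapT => /not_mle Jg.
  by have [_ /(_ J Jg)] := Hg i; apply.
have {}infj k : exists l, [/\ mle k l, Q l j & forall z, z <! j -> ~ Q l z].
  have [l [kl /HG ->]] := infj k; exists l; have [? ?] := Hg l; split=> //.
  by left.
have cohj z : (exists k, forall l, mle k l -> Q l z) \/ (exists k, forall l, mle k l -> ~ Q l z).
  by case: (coh (z, B * (d + 1), d)) => -[k Hk]; [left|right]; exists k => l kl;
    rewrite QE -val_grid; exact: Hk.
have [[k1 H1]|[k1 H1]] := cohj j; last first.
  by have [l [/H1]] := infj k1.
(* Colour 0 is impossible, as grid point 0 is -B; so [j] has a predecessor [z], the lower end of the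
   cell. *)
have [j0|[z jz]] := zero_or_succ j.
  exfalso; have := H1 k1 (mle_refl k1); rewrite j0 QE emb0 mul0r.
  by move: (uB k1); rewrite ler_norml => /andP[+ _]; move: (u k1) (emb B) => x y ? ?; lra.
have zj : z <! j by clear -jz; rewrite jz; apply/ltmS; right.
have [[k2 H2]|[k2 H2]] := cohj z.
  by have [l [/H2 Qz _ /(_ z zj)]] := infj k2.
(* Beyond both thresholds [u] stays in the half-open cell from [z] to [j], whose width [h] is at
   most [eps]. *)
exists (k1 + k2) => m n km kn.
have cell l : mle (k1 + k2) l -> emb z * h - emb B <= u l /\ u l < emb z * h + h - emb B.
  move=> kl; split.
    have := H2 l (mle_trans (mle_add_r k1 k2) kl); rewrite QE => /negP.
    by rewrite -leNgt.
  have := H1 l (mle_trans (mle_add_l k1 k2) kl); rewrite QE jz embD emb1.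
  by rewrite mulrDl mul1r.
move: (cell m km) (cell n kn) => {cell jz}.
move: (u m) (u n) (emb z) (emb B) (h) h0 Hd => x y e f h' h'0 Hd [? ?] [? ?].
by rewrite ltr_norml; apply/andP; split; lra.
Qed.

Lemma BW_of_StCOH : s_COH M -> s_IPP M -> s_BW M.
Proof.
move=> COH IPP X [[valX ucX] [Y [/s_is_realP[w [Yw cw]] bdX]]].
have [a [b [c [ra rb rc Xv]]]] := row_values valX.
have [v vdef] : exists v : N -> N -> frac M, forall n i, val (a n i, b n i, c n i) = v n i.
  by eexists.
have rowv n : reps (s_row X n) (v n).
  by have := reps_row (Xv n); under eq_fun do rewrite vdef.
have ucv : unif_cauchy v by exact/(s_unif_cauchyE rowv).
have [|B [i0 HB]] := uniform_bound ucv cw.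
  by move=> n; apply/(s_xleE (reps_abs (rowv n)) (reps_seq Yw)).
(* The index [p] codes an entry number [i] and a rational q; the set consists of the [n] with x_n,i
   < q, a comparison of rationals and hence Delta_1. *)
pose R p n := exists i, i <! p + 1 /\ exists j, j <! p + 1 /\ exists k, k <! p + 1 /\
  exists d, d <! p + 1 /\ (p = pair i (pair (pair j k) d) /\
    s_qlt (a n i, b n i, c n i) (j, k, d)).
have [|C [infC cohC]] := @cohesive_set R COH.
  by rewrite /dec2 /R /s_qlt /=; solve_D1.
have RE i q n : R (pair i (qcd q)) n <-> v n i < val q.
  rewrite -vdef -s_qltE; case: q => [[j k] d]; split.
    by move=> [i' [_ [j' [_ [k' [_ [d' [_ [/pair_inj[-> /pair_inj[/pair_inj[/= -> ->] /= ->]]]]]]]]]]].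
  have H1 := le_pair_l i (qcd (j, k, d)); have H2 := le_pair_r i (qcd (j, k, d)).
  have H3 := le_pair_l (pair j k) d; have H4 := le_pair_r (pair j k) d.
  have H5 := le_pair_l j k; have H6 := le_pair_r j k; rewrite /qcd /= in H1 H2 *.
  move=> Hlt; exists i; split=> //; exists j; split; first by clear Hlt; mlra.
  exists k; split; first by clear Hlt; mlra.
  by exists d; split; first by clear Hlt; mlra.
have [f [rf incf fC]] := enumeration infC.
have fge i : mle i (f i) by exact: increasing_ge.
(* Only columns from [i0] on are covered, since the bound [B] on the entries holds there. *)
have claim i : mle i0 i -> cauchy (fun l => v (f l) i).
  move=> ii0; have cu : cauchy (fun l => val (a (f l) i, b (f l) i, c (f l) i)).
    apply: (@cauchy_of_cohesive (fun l => a (f l) i) (fun l => b (f l) i)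
      (fun l => c (f l) i) B IPP); try by rewrite /rec1; solve_rec.
      by move=> l; rewrite vdef; exact: HB.
    move=> q; case: (cohC (pair i (qcd q))) => -[k Hk]; [left|right];
      exists (k + 1) => l kl; rewrite vdef -RE; apply: Hk (fC l) _;
      by move: kl (fge l); rewrite !mleE => kl fl; mlra.
  by move=> eps /cu[k Hk]; exists k => m n; rewrite -!vdef; exact: Hk.
have near eps : 0 < eps -> exists K, forall k l k' l', mle K k -> mle K l ->
    mle K k' -> mle K l' -> `|v (f k) l - v (f k') l'| < eps.
  move=> e0; have e3 : 0 < eps / 3 by rewrite divr_gt0.
  (* Column [j + i0] is past the Cauchy index [j] and within the scope of [claim]; both entries are
     compared through it. Four free indices give the Cauchy property of the diagonal as well as
     convergence. *)
  have [j Hj] := ucv _ e3; have [K HK] := claim _ (mle_add_r j i0) _ e3.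
  have jj := mle_add_l j i0.
  exists (K + (j + i0)) => k l k' l' Kk Kl Kk' Kl'.
  have toK := mle_trans (mle_add_l K (j + i0)).
  have toj m : mle (K + (j + i0)) m -> mle j m.
    by move=> Hm; apply: mle_trans jj (mle_trans (mle_add_r K (j + i0)) Hm).
  apply: dist_tri3 (Hj (f k) l _ (toj _ Kl) jj) (HK k k' (toK _ Kk) (toK _ Kk')) _.
  exact: Hj (toj _ Kl') jj.
have [|Z HZ] := @comprehension_dec2 M (fun k j =>
    j = pair (pair (a (f k) k) (b (f k) k)) (c (f k) k)).
  by rewrite /dec2; solve_D1.
have [F HF] := graph_set rf.
exists F; split; first by move=> i; exists (f i) => k; exact: HF.
split; first by move=> i j m n ij /HF -> /HF ->; exact: incf.
apply/(s_convergesE _ rowv).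
exists Z, (fun k => (a (f k) k, b (f k) k, c (f k) k)).
split; [exact: HZ|move=> eps e0|move=> eps e0].
  by have [K HK] := near eps e0; exists K => m n Km Kn; rewrite 2!vdef; exact: HK.
(* Strict order of reals requires a gap: distances below [eps / 2] refute the reverse inequality at
   slack [eps / 4]. *)
have [|K HK] := near (eps / 2); first by rewrite divr_gt0.
exists K => i m Ki /HF ->.
have close l : mle K l -> `|v (f i) l - val (a (f l) l, b (f l) l, c (f l) l)| < eps / 2.
  by move=> Kl; rewrite vdef; exact: HK.
split=> [delta d0|[_ /(_ (eps / 4))[|n Hn]]].
- exists K => l /close; move: `|_| => x ?; lra.
- by rewrite divr_gt0.
move: (Hn _ (mle_add_l n K)) (close _ (mle_add_r n K)); move: `|_| => x ? ?; lra.
Qed.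

End FromStCOH.

Theorem theorem7p9 : provable RCA0 (close (StCOH <--> BW)%L2).
Proof.
apply: completeness => [|M HM e s]; first exact: RCA0_subst.
(* The given valuation provides the set that an [rca_model] must contain. *)
pose M' := RcaModel (s 0%N) HM.
apply: (@sat_theorem M'); split=> [[COH IPP]|BW]; first exact: BW_of_StCOH.
by split; [move=> R; exact: cohesive_of_BW|exact: IPP_of_BW].
Qed.
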